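(* Let $z_1,\ldots,z_n\in\mathbb{D}$ be mutually distinct and let $\underline{\alpha}=(\alpha_1,\ldots,\alpha_n)\in\mathbb{C}^n\setminus\{\mathbf 0\}$. Put $$t=\max\left\{x\ge0:\ \det\left(\frac{1-x^2\alpha_i\overline{\alpha_j}}{1-z_i\overline{z_j}}\right)_{1\le i,j\le n}=0\ \text{ and }\ \left(\frac{1-x^2\alpha_i\overline{\alpha_j}}{1-z_i\overline{z_j}}\right)_{1\le i,j\le n}\ge\mathbf 0\right\},$$ where $\geq \mathbf 0$ means positive semidefinite. Then $t=\dfrac{1}{\mu_{\mathscr{D}_n}(\underline{\alpha})}$.
   Context: $\mathbb{D}$ is the open unit disc in $\mathbb{C}$. $\mathscr{D}_n=\mathscr{D}_{\mathbb{D}}(z_1,\ldots,z_n)=\{(f(z_1),\ldots,f(z_n)): f \text{ holomorphic on }\mathbb{D},\ \sup_{\mathbb{D}}|f|<1\}\subset\mathbb{C}^n$, and $\mu_{\mathscr{D}_n}(\underline{w})=\inf\{s>0: \tfrac1s\underline{w}\in\mathscr{D}_n\}$ is its Minkowski functional. *)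

(* Defs.v *)
From HB Require Import structures.
From mathcomp Require Import all_boot all_order all_algebra.
From mathcomp Require Import sesquilinear spectral.
From mathcomp Require Import all_classical all_reals all_analysis.
From mathcomp Require Import complex.

Set Implicit Arguments.
Unset Strict Implicit.
Unset Printing Implicit Defensive.

Import Order.TTheory GRing.Theory Num.Theory.
Import numFieldNormedType.Exports.

Local Open Scope complex_scope.
Local Open Scope classical_set_scope.
Local Open Scope ring_scope.

Definition unit_disc (R : realType) : set R[i] := [set z | `|z| < 1].

(* Complex differentiability at every point of D (meant for D open): the
   derivative in direction 1 of a map between regular R[i]-modules is the limit
   of (f (z + h) - f z) / h as the complex number h tends to 0, h != 0. *)
Definition holomorphic_on (R : realType) (D : set R[i]) (f : R[i] -> R[i]) :
    Prop :=
  forall z, D z -> derivable (f : R[i]^o -> R[i]^o) z 1.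

(* The supremum is taken in \bar R because the real-valued [sup] of an unbounded
   set is 0; [Normc.normc] is the R-valued complex modulus. *)
Definition interpolation_values (R : realType) (n : nat) (z : 'I_n -> R[i]) :
    set 'rV[R[i]]_n :=
  [set w | exists f : R[i] -> R[i],
    [/\ holomorphic_on (@unit_disc R) f,
        (ereal_sup [set (Normc.normc (f u))%:E | u in @unit_disc R] < 1)%E &
        w = \row_i f (z i)]].

(* [inf] is a real-valued infimum: the value is meaningful only when some
   positive multiple of w lies in A.  This is so for every w when A is
   [interpolation_values z] with the z i pairwise distinct points of the disc,
   by polynomial interpolation. *)
Definition minkowski_functional (R : realType) (n : nat)
    (A : set 'rV[R[i]]_n) (w : 'rV[R[i]]_n) : R :=
  inf [set s : R | 0 < s /\ A ((s^-1)%:C *: w)].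

(* In R[i], 0 <= c means that c is a nonnegative real number, so this forces A
   to be Hermitian. *)
Definition psdmx (R : realType) (n : nat) (A : 'M[R[i]]_n) : Prop :=
  forall v : 'cV[R[i]]_n, 0 <= ((v ^t*)%sesqui *m A *m v) 0 0.

Definition pick_matrix (R : realType) (n : nat) (z : 'I_n -> R[i])
    (alpha : 'rV[R[i]]_n) (x : R) : 'M[R[i]]_n :=
  \matrix_(i, j) ((1 - (x ^+ 2)%:C * alpha 0 i * (alpha 0 j)^*) /
                  (1 - z i * (z j)^*)).

Definition is_max (R : realType) (S : set R) (t : R) : Prop :=
  S t /\ ubound S t.

(* Main.v *)
Require Import Defs.
From mathcomp Require Import all_boot all_order all_algebra.
From mathcomp Require Import sesquilinear spectral.
From mathcomp Require Import all_classical all_reals all_analysis.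
From mathcomp Require Import complex ring lra.

(** The theorem is the Nevanlinna-Pick theorem together with a study of how the
    Pick matrix P(x) of the values x alpha depends on the scale x.

    The quadratic form of P(x) is a - x^2 tau, where a is the form of the Szego
    matrix (1 / (1 - z_i conj z_j)) and tau is the same form after a diagonal
    scaling by alpha. The Szego form is positive definite ([szego_positive]).
    So the scales x with P(x) >= 0 fill an interval [0, t], with t finite since
    alpha <> 0, and P(x) is positive definite for x < t. An invertible positive
    semidefinite matrix stays semidefinite under small perturbations
    ([quadratic_form_perturb]); hence P(t) is singular and t > 0. This t is the
    maximum of the statement, because every x in the set considered there has
    P(x) >= 0.

    If alpha / s is a vector of values of some f with sup |f| < 1, then
    P(1/s) >= 0 and 1/s <= t ([pick_necessity]). If 1/s < t, then P is positive
    definite at some y between 1/s and t, there is an f with |f| <= 1 taking the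
    values y alpha ([pick_sufficiency]), and f / (s y) has supremum less than 1
    and takes the values alpha / s. So the infimum that defines the Minkowski
    functional is 1/t.

    Sufficiency is the Schur algorithm: eliminating the first variable of a Pick
    form leaves the Pick form of the Schur iterate ([pick_form_schur]), which
    has one node fewer. Necessity is the contractivity of multiplication by f,
    tested on combinations of Szego kernels; it needs only the reproducing
    property of these kernels on circles of radius r < 1, that is the Cauchy
    formula for functions known only to be complex differentiable. That formula
    is obtained by contracting the circle to the point p along segments: the
    pulled-back form is closed on a rectangle and periodic, so Goursat's
    bisection ([goursat]) shows that the integral is constant during the
    contraction. *)

Import Order.TTheory GRing.Theory Num.Theory.
Import numFieldNormedType.Exports.

Local Open Scope classical_set_scope.
Local Open Scope ring_scope.

Set Implicit Arguments.
Unset Strict Implicit.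
Unset Printing Implicit Defensive.

(** * Pick forms and the Schur algorithm *)

Section SchurAlgorithm.
Variable C : numClosedFieldType.
Implicit Types (a u v : C).

Definition blaschke a u : C := (u - a) / (1 - a^* * u).

Lemma blaschke_denominator a u : `|a| < 1 -> `|u| <= 1 -> 1 - a^* * u != 0.
Proof.
move=> a1 u1; rewrite subr_eq0; apply/eqP => E.
have : `|a^* * u| < 1.
  rewrite normrM norm_conjC; apply: le_lt_trans a1.
  by rewrite ler_piMr.
by rewrite -E normr1 ltxx.
Qed.

(** The two defects 1 - u conj v differ by a factor that is a rank-one kernel:
    moving a value, or a node, to the origin acts on a Pick matrix as a diagonal
    congruence. *)
Lemma blaschke_defect a u v : `|a| < 1 -> `|u| <= 1 -> `|v| <= 1 ->
  1 - blaschke a u * (blaschke a v)^* =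
  (1 - a * a^*) * (1 - u * v^*) / ((1 - a^* * u) * (1 - a^* * v)^*).
Proof.
move=> a1 u1 v1; have du := blaschke_denominator a1 u1.
have dv : (1 - a^* * v)^* != 0 by rewrite conjC_eq0; exact: blaschke_denominator.
move: dv; rewrite /blaschke rmorphM fmorphV !rmorphB !rmorphM /= conjCK rmorph1 => dv.
by field; rewrite du dv.
Qed.

Lemma norm_blaschke_le1 a u : `|a| < 1 -> `|u| <= 1 -> `|blaschke a u| <= 1.
Proof.
move=> a1 u1; rewrite -(@expr_le1 _ 2) // normCK -subr_ge0 blaschke_defect //.
rewrite -!normCK divr_ge0 ?exprn_ge0 // mulr_ge0 // subr_ge0 exprn_ile1 //.
exact: ltW.
Qed.

Lemma blaschkeN a u : `|a| < 1 -> `|u| <= 1 -> blaschke (- a) (blaschke a u) = u.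
Proof.
move=> a1 u1; have d := blaschke_denominator a1 u1.
have a2 : 1 - a^* * a != 0 by apply: blaschke_denominator => //; exact: ltW.
have d2 : 1 - a^* * u + a^* * (u - a) != 0.
  by rewrite (_ : _ + _ = 1 - a^* * a) //; ring.
rewrite /blaschke rmorphN /=; field; rewrite d /=.
by rewrite (_ : _ - _ = 1 - a^* * u + a^* * (u - a)) //; ring.
Qed.

Lemma blaschke_neq0 a u : `|a| < 1 -> `|u| <= 1 -> u != a -> blaschke a u != 0.
Proof.
by move=> a1 u1 ua; rewrite mulf_neq0 ?subr_eq0 // invr_eq0 blaschke_denominator.
Qed.

(** Gaussian elimination of the first variable: what is left over is the form
    of the Schur complement of the corner entry. *)
Lemma hermitian_complete_square n (A : 'I_n.+1 -> 'I_n.+1 -> C) (c : 'I_n.+1 -> C) :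
  A ord0 ord0 != 0 -> (forall i, A i ord0 = (A ord0 i)^*) ->
  let s := c ord0 + (\sum_(j < n) A ord0 (lift ord0 j) * c (lift ord0 j)) / A ord0 ord0 in
  \sum_i \sum_j (c i)^* * c j * A i j =
  A ord0 ord0 * (s * s^*) +
  \sum_(i < n) \sum_(j < n) (c (lift ord0 i))^* * c (lift ord0 j) *
    (A (lift ord0 i) (lift ord0 j) -
     A (lift ord0 i) ord0 * A ord0 (lift ord0 j) / A ord0 ord0).
Proof.
move=> A0 Ah /=; set sg := \sum_(j < n) A ord0 (lift ord0 j) * c (lift ord0 j).
have sgJ : sg^* = \sum_(i < n) A (lift ord0 i) ord0 * (c (lift ord0 i))^*.
  by rewrite rmorph_sum; apply: eq_bigr => i _; rewrite rmorphM /= -Ah.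
have -> : \sum_i \sum_j (c i)^* * c j * A i j =
    (c ord0)^* * c ord0 * A ord0 ord0 + (c ord0)^* * sg +
    \sum_(i < n) ((c (lift ord0 i))^* * c ord0 * A (lift ord0 i) ord0 +
      \sum_(j < n) (c (lift ord0 i))^* * c (lift ord0 j) * A (lift ord0 i) (lift ord0 j)).
  rewrite big_ord_recl; congr (_ + _).
    rewrite big_ord_recl; congr (_ + _); rewrite /sg mulr_sumr.
    by apply: eq_bigr => j _; ring.
  by apply: eq_bigr => i _; rewrite big_ord_recl.
rewrite big_split /=.
have -> : \sum_(i < n) (c (lift ord0 i))^* * c ord0 * A (lift ord0 i) ord0 = c ord0 * sg^*.
  by rewrite sgJ mulr_sumr; apply: eq_bigr => i _; ring.
have -> : \sum_(i < n) \sum_(j < n) (c (lift ord0 i))^* * c (lift ord0 j) *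
    (A (lift ord0 i) (lift ord0 j) -
     A (lift ord0 i) ord0 * A ord0 (lift ord0 j) / A ord0 ord0) =
    \sum_(i < n) \sum_(j < n) (c (lift ord0 i))^* * c (lift ord0 j) *
      A (lift ord0 i) (lift ord0 j) - sg^* * sg / A ord0 ord0.
  rewrite sgJ !mulr_suml -sumrB; apply: eq_bigr => i _.
  rewrite /sg mulr_sumr mulr_suml -sumrB; apply: eq_bigr => j _; ring.
rewrite rmorphD rmorphM fmorphV /= -Ah.
by field.
Qed.

Lemma conj_pick_entry (a b u v : C) :
  ((1 - a * b^*) / (1 - u * v^*))^* = (1 - b * a^*) / (1 - v * u^*).
Proof.
rewrite rmorphM fmorphV !rmorphB !rmorphM rmorph1 /= !conjCK.
by rewrite [a^* * _]mulrC [u^* * _]mulrC.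
Qed.

Definition pick_form n (z w c : 'I_n -> C) : C :=
  \sum_i \sum_j (c i)^* * c j * ((1 - w i * (w j)^*) / (1 - z i * (z j)^*)).

Definition pick_positive n (z w : 'I_n -> C) :=
  forall c, (exists i, c i != 0) -> 0 < pick_form z w c.

Definition schur_node n (z : 'I_n.+1 -> C) : 'I_n -> C := fun j => z (lift ord0 j).

(** If f maps z_j to w_j, then the first Schur iterate of f at z_0, that is
    (blaschke w_0 o f) / blaschke z_0, maps z_j to these values. *)
Definition schur_value n (z w : 'I_n.+1 -> C) : 'I_n -> C := fun j =>
  blaschke (w ord0) (w (lift ord0 j)) / blaschke (z ord0) (z (lift ord0 j)).

Section Step.
Variables (n : nat) (z w : 'I_n.+1 -> C).
Hypotheses (z1 : forall i, `|z i| < 1) (z_inj : injective z) (w1 : forall i, `|w i| < 1).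

Definition schur_scale (j : 'I_n) : C :=
  (1 - (w ord0)^* * w (lift ord0 j)) * blaschke (z ord0) (z (lift ord0 j)).

Lemma schur_scale_neq0 j : schur_scale j != 0.
Proof.
rewrite mulf_neq0 //; first by apply: blaschke_denominator => //; exact: ltW.
by apply: blaschke_neq0 => //; [exact: ltW|rewrite (inj_eq z_inj)].
Qed.

Let z_gram i j : 1 - z i * (z j)^* != 0.
Proof. by rewrite mulrC; apply: blaschke_denominator => //; exact: ltW. Qed.

Lemma defect_gt0 u : `|u| < 1 -> 0 < 1 - u * u^*.
Proof. by move=> u1; rewrite -normCK subr_gt0 expr_lt1. Qed.

(** The Schur complement of a Pick matrix is, up to a diagonal congruence and a
    positive factor, the Pick matrix of the Schur iterate. *)
Lemma schur_complement (i j : 'I_n) :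
  let P i j := (1 - w i * (w j)^*) / (1 - z i * (z j)^*) in
  P (lift ord0 i) (lift ord0 j) -
    P (lift ord0 i) ord0 * P ord0 (lift ord0 j) / P ord0 ord0 =
  schur_scale i * (schur_scale j)^* *
  ((1 - schur_value z w i * (schur_value z w j)^*) /
   (1 - schur_node z i * (schur_node z j)^*)) / (1 - w ord0 * (w ord0)^*).
Proof.
move=> /=; set i' := lift ord0 i; set j' := lift ord0 j.
have bi : blaschke (z ord0) (z i') != 0.
  by apply: blaschke_neq0 => //; [exact: ltW|rewrite (inj_eq z_inj)].
have bj : (blaschke (z ord0) (z j'))^* != 0.
  by rewrite conjC_eq0; apply: blaschke_neq0 => //; [exact: ltW|rewrite (inj_eq z_inj)].
have k0 : 1 - w ord0 * (w ord0)^* != 0 by rewrite gt_eqF // defect_gt0.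
have k1 : 1 - z ord0 * (z ord0)^* != 0 by exact: z_gram.
have Ew := blaschke_defect (w1 ord0) (ltW (w1 i')) (ltW (w1 j')).
have Ez := blaschke_defect (z1 ord0) (ltW (z1 i')) (ltW (z1 j')).
have ui := blaschke_denominator (w1 ord0) (ltW (w1 i')).
have uj := blaschke_denominator (w1 ord0) (ltW (w1 j')).
have yi := blaschke_denominator (z1 ord0) (ltW (z1 i')).
have yj := blaschke_denominator (z1 ord0) (ltW (z1 j')).
rewrite -conjC_eq0 rmorphB rmorph1 rmorphM /= conjCK in uj.
rewrite -conjC_eq0 rmorphB rmorph1 rmorphM /= conjCK in yj.
have zij := z_gram i' j'.
rewrite /schur_value /schur_scale /schur_node -/i' -/j'.
set bw := blaschke (w ord0) (w i') in Ew *; set bw' := blaschke (w ord0) (w j') in Ew *.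
set bz := blaschke (z ord0) (z i') in Ez bi *.
set bz' := blaschke (z ord0) (z j') in Ez bj *.
(* made opaque so that rmorphM does not see the quotients inside *)
clearbody bw bw' bz bz'.
have -> : (1 - w i' * (w ord0)^*) = (1 - (w ord0)^* * w i') by rewrite mulrC.
have -> : (1 - z i' * (z ord0)^*) = (1 - (z ord0)^* * z i') by rewrite mulrC.
rewrite !rmorphM fmorphV !rmorphB !rmorphM rmorph1 /= conjCK.
rewrite !rmorphB !rmorphM rmorph1 /= !conjCK in Ew Ez.
have Ebw : bw * bw'^* = 1 - (1 - w ord0 * (w ord0)^*) * (1 - w i' * (w j')^*) /
     ((1 - (w ord0)^* * w i') * (1 - w ord0 * (w j')^*)).
  by rewrite -Ew; ring.
have Ebz : bz * bz'^* = 1 - (1 - z ord0 * (z ord0)^*) * (1 - z i' * (z j')^*) /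
     ((1 - (z ord0)^* * z i') * (1 - z ord0 * (z j')^*)).
  by rewrite -Ez; ring.
have -> : (1 - (w ord0)^* * w i') * bz * ((1 - w ord0 * (w j')^*) * bz'^*) *
    ((1 - bw / bz * (bw'^* / bz'^*)) / (1 - z i' * (z j')^*)) / (1 - w ord0 * (w ord0)^*) =
   (1 - (w ord0)^* * w i') * (1 - w ord0 * (w j')^*) * (bz * bz'^* - bw * bw'^*) /
   (1 - z i' * (z j')^*) / (1 - w ord0 * (w ord0)^*).
  by field; rewrite bi bj k0 zij.
rewrite Ebw Ebz; field.
by rewrite k0 k1 ui uj yi yj zij.
Qed.

Lemma pick_form_schur (c : 'I_n.+1 -> C) :
  let P j := (1 - w ord0 * (w j)^*) / (1 - z ord0 * (z j)^*) in
  let s := c ord0 + (\sum_(j < n) P (lift ord0 j) * c (lift ord0 j)) / P ord0 in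
  pick_form z w c = P ord0 * (s * s^*) +
   pick_form (schur_node z) (schur_value z w)
     (fun j => (schur_scale j)^* * c (lift ord0 j)) / (1 - w ord0 * (w ord0)^*).
Proof.
move=> P s; pose A i j := (1 - w i * (w j)^*) / (1 - z i * (z j)^*).
have A0 : A ord0 ord0 != 0.
  by rewrite mulf_neq0 ?invr_eq0 ?z_gram // gt_eqF // defect_gt0.
rewrite /pick_form (@hermitian_complete_square _ A) //; last first.
  by move=> i; rewrite /A conj_pick_entry.
congr (_ + _); rewrite mulr_suml; apply: eq_bigr => i _.
rewrite mulr_suml; apply: eq_bigr => j _.
have -> : ((schur_scale i)^* * c (lift ord0 i))^* = schur_scale i * (c (lift ord0 i))^*.
  by rewrite rmorphM /= conjCK.
rewrite /A schur_complement; ring.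
Qed.

(** Given coefficients for the remaining nodes, the coefficient at z_0 can be
    chosen to make the completed square vanish. *)
Lemma pick_positive_schur : pick_positive z w ->
  pick_positive (schur_node z) (schur_value z w).
Proof.
move=> Pzw c' [i ci].
pose P j := (1 - w ord0 * (w j)^*) / (1 - z ord0 * (z j)^*).
pose sc j := (schur_scale j)^*.
have sc0 j : sc j != 0 by rewrite conjC_eq0 schur_scale_neq0.
pose s' := (\sum_(j < n) P (lift ord0 j) * (c' j / sc j)) / P ord0.
pose c j := if unlift ord0 j is Some k then c' k / sc k else - s'.
have cl j : c (lift ord0 j) = c' j / sc j by rewrite /c liftK.
have c0 : c ord0 = - s' by rewrite /c unlift_none.
have k0 := defect_gt0 (w1 ord0).
have := Pzw c; rewrite pick_form_schur -/P c0.
under eq_bigr => j _ do rewrite cl.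
rewrite addNr mul0r mulr0 add0r.
have -> : (fun j => (schur_scale j)^* * c (lift ord0 j)) = c'.
  by apply/funext => j; rewrite cl mulrC divfK.
rewrite pmulr_lgt0 ?invr_gt0 //; apply; exists (lift ord0 i).
by rewrite cl mulf_neq0 ?invr_eq0.
Qed.

End Step.

Lemma pick_form_single n (z w : 'I_n -> C) i :
  pick_form z w (fun j => (j == i)%:R) = (1 - w i * (w i)^*) / (1 - z i * (z i)^*).
Proof.
rewrite /pick_form (bigD1 i) //= (bigD1 i) //= eqxx conjC1 !mul1r.
rewrite big1 => [|j ji]; last by rewrite (negPf ji) mulr0 mul0r.
rewrite big1 ?addr0 // => j ji.
by apply: big1 => k _; rewrite (negPf ji) conjC0 !mul0r.
Qed.

Lemma pick_positive_norm n (z w : 'I_n -> C) : (forall i, `|z i| < 1) ->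
  pick_positive z w -> forall i, `|w i| < 1.
Proof.
move=> z1 Pzw i; have := Pzw (fun j => (j == i)%:R).
rewrite pick_form_single pmulr_lgt0; last by rewrite invr_gt0; exact: defect_gt0.
rewrite -normCK subr_gt0 expr_lt1 //.
by apply; exists i; rewrite eqxx oner_eq0.
Qed.

(** For the zero values the Schur iterate is again zero, so the same elimination
    step gives an induction on the number of nodes. *)
Lemma szego_positive n (z : 'I_n -> C) : (forall i, `|z i| < 1) -> injective z ->
  pick_positive z (fun=> 0).
Proof.
elim: n z => [|n ih] z z1 z_inj c [i ci]; first by case: i ci.
pose w0 (j : 'I_n.+1) : C := 0; rewrite -[fun=> 0]/w0.
have w01 j : `|w0 j| < 1 by rewrite normr0.
have kappa1 : 1 - w0 ord0 * (w0 ord0)^* = 1 by rewrite mul0r subr0.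
pose P (j : 'I_n.+1) := (1 - w0 ord0 * (w0 j)^*) / (1 - z ord0 * (z j)^*).
pose c' (j : 'I_n) := (schur_scale z w0 j)^* * c (lift ord0 j).
rewrite (pick_form_schur z1 z_inj w01) -/(P ord0) -/c' kappa1 divr1.
have -> : schur_value z w0 = (fun=> 0).
  by apply/funext => j; rewrite /schur_value /blaschke subr0 mul0r mul0r.
have P0 : 0 < P ord0.
  by rewrite /P kappa1 mul1r invr_gt0 defect_gt0.
have z'1 j : `|schur_node z j| < 1 by exact: z1.
have z'_inj : injective (schur_node z) by move=> j k /z_inj /lift_inj.
have [[j c'j]|c'0] := pselect (exists j, c' j != 0).
  apply: ltr_wpDl; last by apply: ih => //; exists j.
  by apply: mulr_ge0; [exact: (ltW P0)|exact: mul_conjC_ge0].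
have cl0 j : c (lift ord0 j) = 0.
  apply/eqP; apply: contra_notT c'0 => cj; exists j.
  by rewrite mulf_neq0 // conjC_eq0 schur_scale_neq0.
have ci0 : c ord0 != 0.
  by move: ci; case: (unliftP ord0 i) => [j ->|-> //]; rewrite cl0 eqxx.
rewrite big1 => [|j _]; last by rewrite cl0 mulr0.
have -> : pick_form (schur_node z) (fun=> 0) c' = 0.
  apply: big1 => j _; apply: big1 => k _.
  by rewrite /c' cl0 mulr0 conjC0 !mul0r.
by rewrite mul0r !addr0; apply: mulr_gt0 => //; rewrite mul_conjC_gt0.
Qed.

End SchurAlgorithm.

Section PickSufficiency.
Variable R : realType.
Local Notation C := (R[i]).

Lemma derivable_blaschke_comp (a : C) (g : C -> C) u :
  derivable (g : C^o -> C^o) u 1 -> 1 - a^* * g u != 0 ->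
  derivable ((fun v => blaschke a (g v)) : C^o -> C^o) u 1.
Proof.
move=> dg d0; rewrite /blaschke.
have dn : derivable ((fun v => g v - a) : C^o -> C^o) u 1.
  by apply: (@derivableB C C^o C^o (g : C^o -> C^o) (cst a)); [exact: dg|exact: derivable_cst].
have dd : derivable ((fun v => 1 - a^* * g v) : C^o -> C^o) u 1.
  apply: (@derivableB C C^o C^o (cst 1) (fun v => a^* * g v : C^o)).
    exact: derivable_cst.
  by apply: (@derivableM C C^o (cst a^*) (g : C^o -> C^o)); [exact: derivable_cst|exact: dg].
apply: (@derivableM C C^o (fun v => g v - a : C^o)); first exact: dn.
by apply: derivableV; [exact: d0|exact: dd].
Qed.

(** The Schur algorithm: the interpolating function is obtained from one for the
    Schur iterate by multiplying with the Blaschke factor of z_0, which frees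
    the value at z_0, and moving the value 0 back to w_0. *)
Theorem pick_sufficiency n (z w : 'I_n -> C) :
  (forall i, `|z i| < 1) -> injective z -> pick_positive z w ->
  exists f : C -> C, [/\ holomorphic_on (@unit_disc R) f,
    forall u, `|u| < 1 -> `|f u| <= 1 & forall i, f (z i) = w i].
Proof.
elim: n z w => [|n ih] z w z1 z_inj Pzw.
  exists (fun=> 0); split.
  - by move=> u _; exact: derivable_cst.
  - by move=> u _; rewrite normr0.
  - by case.
have w1 := pick_positive_norm z1 Pzw.
have [g [dg g1 gw]] := ih _ _ (fun j => z1 _) (fun i j e => lift_inj (z_inj _ _ e))
  (pick_positive_schur z1 z_inj w1 Pzw).
have wN1 : `|- w ord0| < 1 by rewrite normrN.
pose h u := blaschke (z ord0) u * g u.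
have h1 u : `|u| < 1 -> `|h u| <= 1.
  move=> u1; rewrite normrM mulr_ile1 //; last exact: g1.
  by apply: norm_blaschke_le1 => //; exact: ltW.
exists (fun u => blaschke (- w ord0) (h u)); split.
- move=> u u1; apply: derivable_blaschke_comp; last first.
    by apply: blaschke_denominator => //; exact: h1.
  apply: (@derivableM C C^o (fun v => blaschke (z ord0) v : C^o) g); last exact: dg.
  apply: (@derivable_blaschke_comp _ id); first exact: derivable_id.
  by apply: blaschke_denominator => //; exact: ltW.
- by move=> u u1; apply: norm_blaschke_le1 => //; exact: h1.
- move=> i; case: (unliftP ord0 i) => [j ->|->]; last first.
    by rewrite /h /blaschke subrr !mul0r mulr0 subr0 divr1 sub0r opprK.
  have b0 : blaschke (z ord0) (z (lift ord0 j)) != 0.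
    by apply: blaschke_neq0 => //; [exact: ltW|rewrite (inj_eq z_inj)].
  rewrite /h -[g _]/(g (schur_node z j)) gw /schur_value mulrC divfK //.
  by rewrite blaschkeN //; exact: ltW.
Qed.

End PickSufficiency.

(** * Goursat's theorem for closed forms on a rectangle *)

Section Slopes.
Variables (R : realType) (K : numFieldType) (e : R -> K).
Hypothesis e_cont : continuous e.
Implicit Types (G A B : R * R -> K) (x : R * R).

(** Differentiability of G at x in the form of Caratheodory: A x and B x are the
    partial derivatives. Products and compositions then need only algebra and
    the continuity of A and B. The map e embeds the real increments in K. *)
Definition slopes G x A B :=
  [/\ {for x, continuous A}, {for x, continuous B} &
      forall y, G y = G x + e (y.1 - x.1) * A y + e (y.2 - x.2) * B y].

Lemma derivable_caratheodory (H : K -> K) (z : K) : derivable (H : K^o -> K^o) z 1 ->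
  exists2 D : K -> K, {for z, continuous D} & forall y, H y = H z + (y - z) * D y.
Proof.
move=> dH; pose l := 'D_1 (H : K^o -> K^o) z.
pose D y := if y == z then l else (H y - H z) / (y - z).
exists D => [|y]; last first.
  rewrite /D; case: eqVneq => [->|yz]; first by rewrite subrr mul0r addr0.
  by rewrite mulrC divfK ?subr_eq0 // subrKC.
apply/continuous_withinNshiftx; rewrite /D eqxx /=.
have : h^-1 *: ((H \o shift z) (h *: (1 : K^o)) - H z) @[h --> 0^'] --> (l : K^o) by [].
apply: cvg_trans; apply: near_eq_cvg.
near=> h.
have h0 : h != 0 by near: h; exact: nbhs_dnbhs_neq.
rewrite /= -subr_eq0 addrK (negPf h0) [LHS]mulrC.
by rewrite /GRing.scale /= mulr1.
Unshelve. all: by end_near. Qed.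

Lemma slopes_continuous G x A B : slopes G x A B -> {for x, continuous G}.
Proof.
case=> cA cB GE.
have -> : G = (fun y => G x + e (y.1 - x.1) * A y + e (y.2 - x.2) * B y).
  by apply/funext => y; exact: GE.
have c1 : {for x, continuous (fun y : R * R => e (y.1 - x.1))}.
  apply: (@continuous_comp _ _ _ (fun y : R * R => y.1 - x.1) e); last exact: e_cont.
  by apply: cvgB; [exact: cvg_fst|exact: cvg_cst].
have c2 : {for x, continuous (fun y : R * R => e (y.2 - x.2))}.
  apply: (@continuous_comp _ _ _ (fun y : R * R => y.2 - x.2) e); last exact: e_cont.
  by apply: cvgB; [exact: cvg_snd|exact: cvg_cst].
apply: cvgD; last by apply: cvgM.
by apply: cvgD; [exact: cvg_cst|apply: cvgM].
Qed.

Lemma slopesM G1 G2 x A1 B1 A2 B2 :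
  slopes G1 x A1 B1 -> slopes G2 x A2 B2 ->
  slopes (fun y => G1 y * G2 y) x
    (fun y => A1 y * G2 y + G1 x * A2 y) (fun y => B1 y * G2 y + G1 x * B2 y).
Proof.
move=> h1 h2; have c2 := slopes_continuous h2.
case: h1 => cA1 cB1 E1; case: h2 => cA2 cB2 E2; split.
- by apply: cvgD; apply: cvgM => //; exact: cvg_cst.
- by apply: cvgD; apply: cvgM => //; exact: cvg_cst.
- by move=> y; rewrite (E1 y) {1}(E2 y) [in RHS](E2 y); ring.
Qed.

Lemma slopes_comp G x A B (H D : K -> K) :
  slopes G x A B -> {for G x, continuous D} ->
  (forall y, H y = H (G x) + (y - G x) * D y) ->
  slopes (H \o G) x (fun y => A y * D (G y)) (fun y => B y * D (G y)).
Proof.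
move=> h cD HE; have cG := slopes_continuous h.
have cDG : {for x, continuous (D \o G)} by exact: continuous_comp.
case: h => cA cB GE; split; [exact: cvgM|exact: cvgM|].
by move=> y; rewrite /= HE [in X in X * D _](GE y); ring.
Qed.

End Slopes.

Section Goursat.
Variable R : realType.
Implicit Types (a b c d s t : R) (f g : R -> R).

Definition segment_integral a b f : R :=
  \int[lebesgue_measure]_(x in `[a, b]) f x.

(** Two-sided continuity, also at the end points: the integrands below are
    restrictions of functions that are continuous on a larger interval. *)
Definition continuous_on_segment a b f :=
  forall x, a <= x <= b -> {for x, continuous f}.

Lemma continuous_on_segment_integrable a b f : continuous_on_segment a b f ->
  (@lebesgue_measure R).-integrable `[a, b] (EFin \o f).
Proof.
move=> cf; apply: continuous_compact_integrable; first exact: segment_compact.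
apply: continuous_in_subspaceT => x; rewrite inE /= in_itv /=; exact: cf.
Qed.

Lemma segment_integralB a b f g :
  continuous_on_segment a b f -> continuous_on_segment a b g ->
  segment_integral a b (fun x => f x - g x) =
  segment_integral a b f - segment_integral a b g.
Proof.
by move=> cf cg; apply: RintegralB => //; exact: continuous_on_segment_integrable.
Qed.

Lemma segment_integralD a b f g :
  continuous_on_segment a b f -> continuous_on_segment a b g ->
  segment_integral a b (fun x => f x + g x) =
  segment_integral a b f + segment_integral a b g.
Proof.
by move=> cf cg; apply: RintegralD => //; exact: continuous_on_segment_integrable.
Qed.

Lemma segment_integralZ a b k f : continuous_on_segment a b f ->
  segment_integral a b (fun x => k * f x) = k * segment_integral a b f.
Proof.
by move=> cf; apply: RintegralZl => //; exact: continuous_on_segment_integrable.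
Qed.

Lemma segment_integral_cst a b k : a <= b ->
  segment_integral a b (fun=> k) = k * (b - a).
Proof.
move=> ab; rewrite /segment_integral Rintegral_cst //=.
by rewrite lebesgue_measure_itv /= lte_fin; case: ltgtP ab => // -> _; rewrite subrr.
Qed.

Lemma eq_segment_integral a b f g : (forall x, a <= x <= b -> f x = g x) ->
  segment_integral a b f = segment_integral a b g.
Proof.
by move=> fg; apply: eq_Rintegral => x; rewrite inE /= in_itv /=; exact: fg.
Qed.

Lemma segment_integral_cat a m b f : a <= m <= b -> continuous_on_segment a b f ->
  segment_integral a b f = segment_integral a m f + segment_integral m b f.
Proof.
move=> /andP[am mb] cf.
have i1 := continuous_on_segment_integrable cf.
rewrite /segment_integral -[X in _ = _ + X]Rintegral_itv_obnd_cbnd; last first.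
  by apply: integrableS i1 => //; apply: subset_itvr; rewrite bnd_simp.
rewrite -(@Rintegral_itvB _ f (BLeft a) (BRight b) m) //; first by rewrite addrC subrK.
Qed.

Lemma segment_integral_bound a b M f : a <= b -> continuous_on_segment a b f ->
  (forall x, a <= x <= b -> `|f x| <= M) ->
  `|segment_integral a b f| <= M * (b - a).
Proof.
move=> ab cf fM; rewrite -segment_integral_cst //.
have i1 := continuous_on_segment_integrable cf.
apply: le_trans (le_normr_Rintegral _ i1) _ => //.
have cn : continuous_on_segment a b (fun x => `|f x|).
  by move=> x xab; apply: (@continuous_comp _ _ _ f Num.norm); [exact: cf|exact: norm_continuous].
apply: le_Rintegral => //.
- exact: continuous_on_segment_integrable cn.
- by apply: continuous_on_segment_integrable => x _; exact: cst_continuous.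
Qed.

Lemma segment_integral_ge0 a b f : (forall x, 0 <= f x) -> 0 <= segment_integral a b f.
Proof. by move=> f0; apply: Rintegral_ge0. Qed.

Lemma nested_segments (u e : nat -> R) : (forall n, 0 <= e n) ->
  (forall n, u n <= u n.+1) -> (forall n, u n.+1 + e n.+1 <= u n + e n) ->
  exists l, forall n, u n <= l <= u n + e n.
Proof.
move=> e0 up down.
have upm : {homo u : m n / (m <= n)%N >-> m <= n}.
  by apply: homo_leq => // ? ? ?; exact: le_trans.
have dnm : {homo (fun n => u n + e n) : m n / (m <= n)%N >-> n <= m}.
  by apply: homo_leq => // y x v; move=> /[swap]; exact: le_trans.
have ub m n : u m <= u n + e n.
  have [mn|/ltnW nm] := leqP m n.
    by apply: le_trans (upm _ _ mn) _; rewrite lerDl.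
  by apply: le_trans (dnm _ _ nm); rewrite lerDl.
have hs : has_sup (range u).
  by split; [exists (u 0%N), 0%N|exists (u 0%N + e 0%N) => _ [m _ <-]].
exists (sup (range u)) => n; apply/andP; split.
  by apply: sup_upper_bound => //; exists n.
by apply: ge_sup => [|_ [m _ <-]]; [exact: hs.1|].
Qed.

(** A rectangle of stage n is encoded by its lower left corner; its sides are
    h / 2^n and k / 2^n. *)
Definition subrectangle (h k : R) n (p q : R * R) :=
  [/\ p.1 <= q.1, q.1 + h / 2 ^+ n.+1 <= p.1 + h / 2 ^+ n,
      p.2 <= q.2 & q.2 + k / 2 ^+ n.+1 <= p.2 + k / 2 ^+ n].

(** The lower left corners of a chosen sequence increase and the upper right
    corners decrease, so the supremum of the former lies in all rectangles. *)
Lemma nested_rectangles (h k : R) (Bad : nat -> R * R -> Prop) (p0 : R * R) :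
  0 <= h -> 0 <= k -> Bad 0%N p0 ->
  (forall n p, Bad n p -> exists2 q, Bad n.+1 q & subrectangle h k n p q) ->
  exists x : R * R, [/\ p0.1 <= x.1 <= p0.1 + h, p0.2 <= x.2 <= p0.2 + k &
    forall n, exists p, [/\ Bad n p, p.1 <= x.1 <= p.1 + h / 2 ^+ n &
                            p.2 <= x.2 <= p.2 + k / 2 ^+ n]].
Proof.
move=> h0 k0 bad0 step.
have /choice[f fP] : forall np : nat * (R * R), exists q,
    Bad np.1 np.2 -> Bad np.1.+1 q /\ subrectangle h k np.1 np.2 q.
  move=> [n p]; have [/step[q bq sq]|nb] := pselect (Bad n p); first by exists q.
  by exists p.
pose u := fix u n := if n is m.+1 then f (m, u m) else p0.
have badu n : Bad n (u n).
  by elim: n => [//|n ih]; have [] := fP (n, u n) ih.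
have subu n : subrectangle h k n (u n) (u n.+1).
  by have [] := fP (n, u n) (badu n).
have [x1 x1P] : exists l, forall n, (u n).1 <= l <= (u n).1 + h / 2 ^+ n.
  apply: (@nested_segments (fun n => (u n).1) (fun n => h / 2 ^+ n)) => n.
  - by rewrite divr_ge0 // exprn_ge0.
  - by case: (subu n).
  - by case: (subu n).
have [x2 x2P] : exists l, forall n, (u n).2 <= l <= (u n).2 + k / 2 ^+ n.
  apply: (@nested_segments (fun n => (u n).2) (fun n => k / 2 ^+ n)) => n.
  - by rewrite divr_ge0 // exprn_ge0.
  - by case: (subu n).
  - by case: (subu n).
exists (x1, x2); split => /=.
- by have := x1P 0%N; rewrite /= expr0 divr1.
- by have := x2P 0%N; rewrite /= expr0 divr1.
- by move=> n; exists (u n); split.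
Qed.

(** The integral of P ds + Q dt along the boundary, counterclockwise. *)
Definition rectangle_integral (P Q : R * R -> R) a b c d :=
  segment_integral a b (fun s => P (s, c) - P (s, d)) +
  segment_integral c d (fun t => Q (b, t) - Q (a, t)).

Definition rectangle a b c d : set (R * R) :=
  [set x | a <= x.1 <= b /\ c <= x.2 <= d].

Lemma continuous_slice1 (P : R * R -> R) s t :
  {for (s, t), continuous P} -> {for s, continuous (fun x => P (x, t))}.
Proof.
move=> cP; apply: (@continuous_comp _ _ _ (fun x : R => (x, t)) P) => //.
by apply: (@cvg_pair _ _ _ _ (nbhs s) (nbhs t)); [exact: cvg_id|exact: cvg_cst].
Qed.

Lemma continuous_slice2 (P : R * R -> R) s t :
  {for (s, t), continuous P} -> {for t, continuous (fun x => P (s, x))}.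
Proof.
move=> cP; apply: (@continuous_comp _ _ _ (fun x : R => (s, x)) P) => //.
by apply: (@cvg_pair _ _ _ _ (nbhs s) (nbhs t)); [exact: cvg_cst|exact: cvg_id].
Qed.

Lemma rectangle_integral_quarters P Q a m b c l d :
  a <= m <= b -> c <= l <= d ->
  (forall x, rectangle a b c d x -> {for x, continuous P}) ->
  (forall x, rectangle a b c d x -> {for x, continuous Q}) ->
  rectangle_integral P Q a b c d =
  rectangle_integral P Q a m c l + rectangle_integral P Q m b c l +
  (rectangle_integral P Q a m l d + rectangle_integral P Q m b l d).
Proof.
move=> amb cld cP cQ.
case/andP: (amb) => am mb; case/andP: (cld) => cl ld.
have Ps y a' b' : a <= a' -> b' <= b -> c <= y <= d ->
    continuous_on_segment a' b' (fun s => P (s, y)).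
  move=> aa bb cyd x /andP[ax xb]; apply: continuous_slice1; apply: cP.
  by split => //=; apply/andP; split; [exact: le_trans ax|exact: le_trans xb bb].
have Qs y c' d' : c <= c' -> d' <= d -> a <= y <= b ->
    continuous_on_segment c' d' (fun t => Q (y, t)).
  move=> aa bb cyd x /andP[ax xb]; apply: continuous_slice2; apply: cQ.
  by split => //=; apply/andP; split; [exact: le_trans ax|exact: le_trans xb bb].
have ab := le_trans am mb; have cd := le_trans cl ld.
rewrite /rectangle_integral !segment_integralB; do ?[by apply: Ps; lra|by apply: Qs; lra].
have Pc y : c <= y <= d -> segment_integral a b (fun s => P (s, y)) =
    segment_integral a m (fun s => P (s, y)) + segment_integral m b (fun s => P (s, y)).
  by move=> yy; apply: segment_integral_cat => //; apply: Ps.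
have Qc y : a <= y <= b -> segment_integral c d (fun s => Q (y, s)) =
    segment_integral c l (fun s => Q (y, s)) + segment_integral l d (fun s => Q (y, s)).
  by move=> yy; apply: segment_integral_cat => //; apply: Qs.
rewrite !Pc ?Qc; [ring|lra..].
Qed.

(** The form P ds + Q dt is closed at x: the mixed partials B x and A' x agree. *)
Definition closed_at (P Q : R * R -> R) (x : R * R) :=
  exists A B A' B', [/\ slopes id P x A B, slopes id Q x A' B' & B x = A' x].

Lemma continuous_near_pair (A : R * R -> R) (x : R * R) (e : R) : 0 < e ->
  {for x, continuous A} -> exists2 dlt, 0 < dlt &
  forall y, `|y.1 - x.1| < dlt -> `|y.2 - x.2| < dlt -> `|A y - A x| <= e.
Proof.
move=> e0 /cvgrPdist_le /(_ e e0) /nbhs_ballP [dlt /= d0 H]; exists dlt => // y y1 y2.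
by rewrite distrC; apply: H; split; rewrite /ball /= distrC.
Qed.

Lemma closed_at_continuousl P Q x : closed_at P Q x -> {for x, continuous P}.
Proof. by move=> [A [B [A' [B' [sP _ _]]]]]; apply: slopes_continuous sP => ?; exact: cvg_id. Qed.

Lemma closed_at_continuousr P Q x : closed_at P Q x -> {for x, continuous Q}.
Proof. by move=> [A [B [A' [B' [_ sQ _]]]]]; apply: slopes_continuous sQ => ?; exact: cvg_id. Qed.

(** The linear parts of P and Q at x contribute nothing to the boundary integral,
    because the mixed partials agree. The remainders are o(diameter) on a
    boundary whose length is O(diameter). *)
Lemma closed_at_small (P Q : R * R -> R) (x : R * R) (e : R) : 0 < e ->
  closed_at P Q x ->
  exists2 dlt, 0 < dlt & forall a b c d, rectangle a b c d x ->
    (forall y, rectangle a b c d y -> closed_at P Q y) ->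
    (b - a) + (d - c) < dlt ->
    `|rectangle_integral P Q a b c d| <= 2 * e * ((b - a) + (d - c)) ^+ 2.
Proof.
move=> e0 [A [B [A' [B' [[cA cB PE] [cA' cB' QE] BA]]]]].
have [d1 d10 hA] := continuous_near_pair e0 cA.
have [d2 d20 hB] := continuous_near_pair e0 cB.
have [d3 d30 hA'] := continuous_near_pair e0 cA'.
have [d4 d40 hB'] := continuous_near_pair e0 cB'.
exists (Num.min (Num.min d1 d2) (Num.min d3 d4)).
  by rewrite !lt_min d10 d20 d30 d40.
move=> a b c d [x1 x2] cl; rewrite !lt_min => /andP[/andP[s1 s2] /andP[s3 s4]].
have [ax1 x1b] := andP x1; have [cx2 x2d] := andP x2.
have ab := le_trans ax1 x1b; have cd := le_trans cx2 x2d.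
have near dl s t : (b - a) + (d - c) < dl -> a <= s <= b -> c <= t <= d ->
    `|s - x.1| < dl /\ `|t - x.2| < dl.
  by move=> ? /andP[? ?] /andP[? ?]; rewrite !ltr_norml; split; lra.
have Pc y : c <= y <= d -> continuous_on_segment a b (fun s => P (s, y)).
  move=> cyd s asb; apply/continuous_slice1.
  by apply: (@closed_at_continuousl P Q); apply: cl.
have Qc y : a <= y <= b -> continuous_on_segment c d (fun t => Q (y, t)).
  move=> ayb t ctd; apply/continuous_slice2.
  by apply: (@closed_at_continuousr P Q); apply: cl.
pose k := B x.
have cst a' b' r : continuous_on_segment a' b' (fun=> r : R).
  by move=> y _; exact: cvg_cst.
have ccd : c <= c <= d by lra.
have dcd : c <= d <= d by lra.
have aab : a <= a <= b by lra.
have bab : a <= b <= b by lra.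
have cP : continuous_on_segment a b (fun s => P (s, c) - P (s, d)).
  by move=> s ss; apply: cvgB; exact: Pc.
have cQ : continuous_on_segment c d (fun t => Q (b, t) - Q (a, t)).
  by move=> s ss; apply: cvgB; exact: Qc.
have -> : rectangle_integral P Q a b c d =
    segment_integral a b (fun s => P (s, c) - P (s, d) - k * (c - d)) +
    segment_integral c d (fun t => Q (b, t) - Q (a, t) - k * (b - a)).
  rewrite /rectangle_integral (segment_integralB cP (cst _ _ _)).
  rewrite (segment_integralB cQ (cst _ _ _)) !segment_integral_cst //; ring.
(* the remainder of either coefficient across the rectangle *)
have bnd (u v w m1 m2 : R) (a1 a2 b1 b2 : R) : `|a1| <= e -> `|a2| <= e ->
    `|b1| <= e -> `|b2| <= e -> `|u| <= m1 -> `|v| + `|w| <= m2 -> 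
    `|u * (a1 - a2) + (v * b1 - w * b2)| <= 2 * e * (m1 + m2).
  move=> ha1 ha2 hb1 hb2 hu hvw.
  have m10 : 0 <= m1 by apply: le_trans hu.
  have h1 : `|u * (a1 - a2)| <= m1 * (2 * e).
    rewrite normrM ler_pM //; apply: le_trans (ler_normB _ _) _; lra.
  have h2 : `|v * b1 - w * b2| <= m2 * e.
    apply: le_trans (ler_normB _ _) _; rewrite !normrM.
    apply: (@le_trans _ _ ((`|v| + `|w|) * e)).
      by rewrite mulrDl lerD // ler_wpM2l.
    by rewrite ler_wpM2r // ltW.
  have m20 : 0 <= m2 * e by apply: le_trans h2.
  apply: le_trans (ler_normD _ _) _; apply: le_trans (lerD h1 h2) _; lra.
have hP : `|segment_integral a b (fun s => P (s, c) - P (s, d) - k * (c - d))| <=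
    2 * e * ((b - a) + (d - c)) * (b - a).
  apply: segment_integral_bound => //.
    by move=> y yy; apply: cvgB; [exact: cP|exact: cvg_cst].
  move=> s sab; rewrite (PE (s, c)) (PE (s, d)) /=.
  have -> : P x + (s - x.1) * A (s, c) + (c - x.2) * B (s, c) -
     (P x + (s - x.1) * A (s, d) + (d - x.2) * B (s, d)) - k * (c - d) =
     (s - x.1) * ((A (s, c) - A x) - (A (s, d) - A x)) +
     ((c - x.2) * (B (s, c) - B x) - (d - x.2) * (B (s, d) - B x)).
    by rewrite /k; ring.
  have [n1 n1'] := near _ _ _ s1 sab ccd. have [n2 n2'] := near _ _ _ s1 sab dcd.
  have [n3 n3'] := near _ _ _ s2 sab ccd. have [n4 n4'] := near _ _ _ s2 sab dcd.
  apply: bnd; [exact: hA|exact: hA|exact: hB|exact: hB| |].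
    by case/andP: sab => ? ?; rewrite ler_norml; lra.
  by rewrite ler0_norm ?ger0_norm; lra.
have hQ : `|segment_integral c d (fun t => Q (b, t) - Q (a, t) - k * (b - a))| <=
    2 * e * ((b - a) + (d - c)) * (d - c).
  apply: segment_integral_bound => //.
    by move=> y yy; apply: cvgB; [exact: cQ|exact: cvg_cst].
  move=> t tcd; rewrite (QE (b, t)) (QE (a, t)) /=.
  have -> : Q x + (b - x.1) * A' (b, t) + (t - x.2) * B' (b, t) -
     (Q x + (a - x.1) * A' (a, t) + (t - x.2) * B' (a, t)) - k * (b - a) =
     (t - x.2) * ((B' (b, t) - B' x) - (B' (a, t) - B' x)) +
     ((b - x.1) * (A' (b, t) - A' x) - (a - x.1) * (A' (a, t) - A' x)).
    by rewrite /k BA; ring.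
  have [n1 n1'] := near _ _ _ s3 bab tcd. have [n2 n2'] := near _ _ _ s3 aab tcd.
  have [n3 n3'] := near _ _ _ s4 bab tcd. have [n4 n4'] := near _ _ _ s4 aab tcd.
  rewrite [b - a + _]addrC.
  apply: bnd; [exact: hB'|exact: hB'|exact: hA'|exact: hA'| |].
    by case/andP: tcd => ? ?; rewrite ler_norml; lra.
  by rewrite ger0_norm ?ler0_norm; lra.
apply: le_trans (ler_normD _ _) _; apply: le_trans (lerD hP hQ) _.
by rewrite -mulrDr expr2 mulrA.
Qed.

(** Goursat's bisection: otherwise one of the four quarters of each rectangle
    keeps at least a quarter of the integral. The nested quarters shrink to a
    point at which the integral is o(diameter^2), a contradiction. *)
Theorem goursat (P Q : R * R -> R) a b c d : a <= b -> c <= d ->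
  (forall x, rectangle a b c d x -> closed_at P Q x) ->
  rectangle_integral P Q a b c d = 0.
Proof.
move=> ab cd cl; apply/eqP; apply/negPn/negP => I0.
set K := `|rectangle_integral P Q a b c d|.
have K0 : 0 < K by rewrite normr_gt0.
pose h := b - a; pose k := d - c.
have h0 : 0 <= h by rewrite subr_ge0.
have k0 : 0 <= k by rewrite subr_ge0.
pose Bad n (p : R * R) := [/\ a <= p.1, p.1 + h / 2 ^+ n <= b, c <= p.2,
   p.2 + k / 2 ^+ n <= d &
   K / 4 ^+ n <= `|rectangle_integral P Q p.1 (p.1 + h / 2 ^+ n) p.2 (p.2 + k / 2 ^+ n)|].
have bad0 : Bad 0%N (a, c).
  by rewrite /Bad /= !expr0 !divr1 /h /k; split; rewrite ?subrKC.
have step n p : Bad n p -> exists2 q, Bad n.+1 q & subrectangle h k n p q.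
  move=> [ap pb cp pd Kp].
  have hn2 : h / 2 ^+ n = h / 2 ^+ n.+1 + h / 2 ^+ n.+1.
    by rewrite exprS invfM mulrCA; field; rewrite expf_neq0.
  have kn2 : k / 2 ^+ n = k / 2 ^+ n.+1 + k / 2 ^+ n.+1.
    by rewrite exprS invfM mulrCA; field; rewrite expf_neq0.
  have K4 : K / 4 ^+ n = 4 * (K / 4 ^+ n.+1).
    by rewrite exprS; field; rewrite expf_neq0.
  move: Kp pb pd; rewrite /Bad /subrectangle.
  rewrite hn2 kn2 K4.
  set h' := h / _; set k' := k / _; set K' := K / _ => Kp pb pd.
  have h'0 : 0 <= h' by rewrite divr_ge0 // exprn_ge0.
  have k'0 : 0 <= k' by rewrite divr_ge0 // exprn_ge0.
  have sub x : rectangle p.1 (p.1 + (h' + h')) p.2 (p.2 + (k' + k')) x -> closed_at P Q x.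
    by move=> [x1 x2]; apply: cl; split; lra.
  move: Kp; rewrite (rectangle_integral_quarters (m := p.1 + h') (l := p.2 + k')); first last.
  - by move=> x /sub; exact: closed_at_continuousr.
  - by move=> x /sub; exact: closed_at_continuousl.
  - by lra.
  - by lra.
  rewrite [p.1 + (h' + h')]addrA [p.2 + (k' + k')]addrA.
  set I1 := rectangle_integral P Q p.1 _ p.2 _.
  set I2 := rectangle_integral P Q (p.1 + h') _ p.2 _.
  set I3 := rectangle_integral P Q p.1 _ (p.2 + k') _.
  set I4 := rectangle_integral P Q (p.1 + h') _ (p.2 + k') _.
  move=> Kp.
  have [b1|b1] := leP K' `|I1|; first by exists p => //; split => //; lra.
  have [b2|b2] := leP K' `|I2|; first by exists (p.1 + h', p.2) => //; split => //=; lra.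
  have [b3|b3] := leP K' `|I3|; first by exists (p.1, p.2 + k') => //; split => //=; lra.
  have [b4|b4] := leP K' `|I4|; first by exists (p.1 + h', p.2 + k') => //; split => //=; lra.
  have : `|I1 + I2 + (I3 + I4)| <= `|I1| + `|I2| + `|I3| + `|I4|.
    have := ler_normD (I1 + I2) (I3 + I4).
    have := ler_normD I1 I2; have := ler_normD I3 I4.
    lra.
  lra.
have [x [/= x1 x2 xn]] := nested_rectangles h0 k0 bad0 step.
have clx : closed_at P Q x by apply: cl; split; move: x1 x2; rewrite /h /k !subrKC.
pose L := h + k.
have L0 : 0 <= L by rewrite addr_ge0.
(* any e with 2 e L^2 < K works; the + 1 avoids a division by zero *)
pose e := K / (4 * (L ^+ 2 + 1)).
have e0 : 0 < e by rewrite divr_gt0 // mulr_gt0 // ltr_wpDl // sqr_ge0.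
have [dl dl0 small] := closed_at_small e0 clx.
have [n Ln] : exists n, L / 2 ^+ n < dl.
  exists (Num.bound (L / dl)).
  rewrite ltr_pdivrMr ?exprn_gt0 // mulrC -ltr_pdivrMr //.
  apply: lt_trans (archi_boundP (divr_ge0 L0 (ltW dl0))) _.
  by rewrite -natrX ltr_nat ltn_expl.
have [p [[ap pb cp pd Kp] px1 px2]] := xn n.
have h'0 : 0 <= h / 2 ^+ n by rewrite divr_ge0 // exprn_ge0.
have k'0 : 0 <= k / 2 ^+ n by rewrite divr_ge0 // exprn_ge0.
have sz : p.1 + h / 2 ^+ n - p.1 + (p.2 + k / 2 ^+ n - p.2) = L / 2 ^+ n.
  by rewrite /L; ring.
have := small p.1 (p.1 + h / 2 ^+ n) p.2 (p.2 + k / 2 ^+ n); rewrite sz.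
move=> /(_ _ _ Ln) H.
have : `|rectangle_integral P Q p.1 (p.1 + h / 2 ^+ n) p.2 (p.2 + k / 2 ^+ n)|
    <= 2 * e * (L / 2 ^+ n) ^+ 2.
  apply: H => [|y [y1 y2]]; first by split.
  by apply: cl; split; lra.
move=> /(le_trans Kp); rewrite expr_div_n -exprM mulnC exprM.
have -> : 2 ^+ 2 = 4 :> R by rewrite expr2; ring.
rewrite mulrA ler_pM2r ?invr_gt0 ?exprn_gt0 // leNgt => /negP; apply.
rewrite /e.
have q0 : 0 < L ^+ 2 + 1 by rewrite ltr_wpDl // sqr_ge0.
have -> : 2 * (K / (4 * (L ^+ 2 + 1))) * L ^+ 2 = K * (L ^+ 2 / (2 * (L ^+ 2 + 1))).
  by field; lra.
rewrite gtr_pMr // ltr_pdivrMr; lra.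
Qed.

(** With P periodic in t the two horizontal sides cancel: the integral of Q in t
    does not depend on s. This takes the place of differentiating under the
    integral sign. *)
Corollary periodic_closed_integral (P Q : R * R -> R) a b c d : a <= b -> c <= d ->
  (forall s, P (s, c) = P (s, d)) ->
  (forall x, rectangle a b c d x -> closed_at P Q x) ->
  segment_integral c d (fun t => Q (a, t)) = segment_integral c d (fun t => Q (b, t)).
Proof.
move=> ab cd per cl.
have Qc y : a <= y <= b -> continuous_on_segment c d (fun t => Q (y, t)).
  move=> ayb t ctd; apply/continuous_slice2.
  by apply: (closed_at_continuousr (P := P)); apply: cl.
have := goursat ab cd cl; rewrite /rectangle_integral.
rewrite (eq_segment_integral (g := fun=> 0)) => [|x _]; last by rewrite per subrr.
rewrite segment_integral_cst // mul0r add0r segment_integralB; last 2 first.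
- by apply: Qc; lra.
- by apply: Qc; lra.
by move=> /eqP; rewrite subr_eq0 => /eqP.
Qed.

End Goursat.

(** * The Cauchy formula on a circle *)

Section Cauchy.
Variable R : realType.
Local Notation C := (R[i]).
Implicit Types (s t : R) (x : R * R).

Lemma norm_normcE (z : C) : `|z| = (Normc.normc z)%:C%C.
Proof. by case: z. Qed.

Lemma normc_geRe (z : C) : `|complex.Re z| <= Normc.normc z.
Proof. by rewrite -lecR -norm_normcE normc_ge_Re. Qed.

Lemma normc_geIm (z : C) : `|complex.Im z| <= Normc.normc z.
Proof.
case: z => a b /=; rewrite -sqrtr_sqr ler_sqrt ?addr_ge0 ?sqr_ge0 //.
by rewrite lerDr sqr_ge0.
Qed.

Lemma ReB (z w : C) : complex.Re (z - w) = complex.Re z - complex.Re w.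
Proof. by case: z w => a b []. Qed.

Lemma ImB (z w : C) : complex.Im (z - w) = complex.Im z - complex.Im w.
Proof. by case: z w => a b []. Qed.

Lemma continuous_real_complex : continuous (fun t : R => t%:C%C : C^o).
Proof.
move=> t; apply/cvgrPdist_lt => e; rewrite ltcE /= => /andP[/eqP ei e0].
near=> u; rewrite -rmorphB norm_normcE /= expr0n addr0 sqrtr_sqr ltcE /= ei eqxx /=.
by near: u; exact: (@cvgr_dist_lt _ _ _ (nbhs t) _ idfun).
Unshelve. all: by end_near. Qed.

Lemma continuous_Re : continuous (@complex.Re R : C^o -> R).
Proof.
move=> z; apply/(@cvgrPdist_lt _ _ _ (nbhs (z : C^o))) => e e0.
near=> u; rewrite -ReB.
apply: le_lt_trans (normc_geRe _) _; rewrite -ltcR -norm_normcE.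
near: u; apply: (nbhsx_ballx (z : C^o) (e%:C)%C).
by rewrite ltcR.
Unshelve. all: by end_near. Qed.

Lemma continuous_Im : continuous (@complex.Im R : C^o -> R).
Proof.
move=> z; apply/(@cvgrPdist_lt _ _ _ (nbhs (z : C^o))) => e e0.
near=> u; rewrite -ImB.
apply: le_lt_trans (normc_geIm _) _; rewrite -ltcR -norm_normcE.
near: u; apply: (nbhsx_ballx (z : C^o) (e%:C)%C).
by rewrite ltcR.
Unshelve. all: by end_near. Qed.

Local Notation rc := (fun t : R => t%:C%C : C).

Lemma slopes_Re (G A B : R * R -> C) x : slopes rc G x A B ->
  slopes id (fun y => complex.Re (G y)) x
    (fun y => complex.Re (A y)) (fun y => complex.Re (B y)).
Proof.
case=> cA cB GE; split.
- apply: (@continuous_comp _ _ _ (A : _ -> C^o) (@complex.Re R)).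
    exact: cA.
  exact: continuous_Re.
- apply: (@continuous_comp _ _ _ (B : _ -> C^o) (@complex.Re R)).
    exact: cB.
  exact: continuous_Re.
- move=> y; rewrite GE; case: (G x) (A y) (B y) => a b [a1 b1] [a2 b2] /=; ring.
Qed.

Lemma slopes_Im (G A B : R * R -> C) x : slopes rc G x A B ->
  slopes id (fun y => complex.Im (G y)) x
    (fun y => complex.Im (A y)) (fun y => complex.Im (B y)).
Proof.
case=> cA cB GE; split.
- apply: (@continuous_comp _ _ _ (A : _ -> C^o) (@complex.Im R)).
    exact: cA.
  exact: continuous_Im.
- apply: (@continuous_comp _ _ _ (B : _ -> C^o) (@complex.Im R)).
    exact: cB.
  exact: continuous_Im.
- move=> y; rewrite GE; case: (G x) (A y) (B y) => a b [a1 b1] [a2 b2] /=; ring.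
Qed.

Definition complex_integral (a b : R) (g : R -> C) : C :=
  (segment_integral a b (fun t => complex.Re (g t)) +i*
   segment_integral a b (fun t => complex.Im (g t)))%C.

Lemma periodic_closed_complex_integral (P Q : R * R -> C) (a b c d : R) :
  a <= b -> c <= d -> (forall s, P (s, c) = P (s, d)) ->
  (forall x, rectangle a b c d x -> exists A B A' B',
     [/\ slopes rc P x A B, slopes rc Q x A' B' & B x = A' x]) ->
  complex_integral c d (fun t => Q (a, t)) = complex_integral c d (fun t => Q (b, t)).
Proof.
move=> ab cd per cl; congr (_ +i* _)%C.
- apply: (@periodic_closed_integral _ (fun y => complex.Re (P y))
    (fun y => complex.Re (Q y))) => //.
    by move=> s; rewrite per.
  move=> x /cl [A [B [A' [B' [sP sQ BA]]]]].
  exists (fun y => complex.Re (A y)), (fun y => complex.Re (B y)),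
    (fun y => complex.Re (A' y)), (fun y => complex.Re (B' y)).
  by split; [exact: slopes_Re|exact: slopes_Re|rewrite BA].
- apply: (@periodic_closed_integral _ (fun y => complex.Im (P y))
    (fun y => complex.Im (Q y))) => //.
    by move=> s; rewrite per.
  move=> x /cl [A [B [A' [B' [sP sQ BA]]]]].
  exists (fun y => complex.Im (A y)), (fun y => complex.Im (B y)),
    (fun y => complex.Im (A' y)), (fun y => complex.Im (B' y)).
  by split; [exact: slopes_Im|exact: slopes_Im|rewrite BA].
Qed.

Definition circle (r t : R) : C := (r * cos t +i* (r * sin t))%C.

Lemma circle_caratheodory r t0 : exists2 D : R -> C,
  {for t0, continuous (D : R -> C^o)} & D t0 = 'i%C * circle r t0 /\
  forall t, circle r t = circle r t0 + (t - t0)%:C%C * D t.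
Proof.
have /is_derive1_caratheodory[g [gE cg gx]] := is_derive_cos t0.
have /is_derive1_caratheodory[h [hE ch hx]] := is_derive_sin t0.
exists (fun t => (r * g t)%:C%C + 'i%C * (r * h t)%:C%C).
  have cr (k : R -> R) : {for t0, continuous k} ->
      {for t0, continuous (fun t => (r * k t)%:C%C : C^o)}.
    move=> ck; apply: (@continuous_comp _ _ _ (fun t => r * k t) (fun t : R => t%:C%C : C^o)).
      by apply: cvgM => //; exact: cvg_cst.
    exact: continuous_real_complex.
  apply: cvgD; first exact: cr.
  by apply: (@cvgM C _ (nbhs t0)); [exact: cvg_cst|exact: cr].
split.
  by rewrite gx hx /circle; apply/eqP; rewrite eq_complex /=; apply/andP; split; apply/eqP; ring.
move=> t; rewrite /circle; apply/eqP; rewrite eq_complex /=; apply/andP; split; apply/eqP.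
  by have := gE t => /eqP; rewrite subr_eq => /eqP ->; ring.
by have := hE t => /eqP; rewrite subr_eq => /eqP ->; ring.
Qed.

Lemma normc_circle r t : 0 <= r -> `|circle r t| = r%:C%C.
Proof.
move=> r0; rewrite normc_def /=; congr (_%:C)%C.
have -> : (r * cos t) ^+ 2 + (r * sin t) ^+ 2 = r ^+ 2 * (cos t ^+ 2 + sin t ^+ 2) by ring.
by rewrite cos2Dsin2 mulr1 sqrtr_sqr ger0_norm.
Qed.

Lemma caratheodory_continuous (H D : C -> C) (z : C) :
  {for z, continuous (D : C^o -> C^o)} ->
  (forall y, H y = H z + (y - z) * D y) -> {for z, continuous (H : C^o -> C^o)}.
Proof.
move=> cD HE.
have -> : H = (fun y => H z + (y - z) * D y) by apply/funext => y; exact: HE.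
apply: (@cvgD C C^o _ (nbhs (z : C^o))); first exact: cvg_cst.
apply: (@cvgM C C^o (nbhs (z : C^o))); last exact: cD.
by apply: (@cvgB C C^o _ (nbhs (z : C^o))); [exact: cvg_id|exact: cvg_cst].
Qed.

Lemma derivable_continuous (H : C -> C) (z : C) : derivable (H : C^o -> C^o) z 1 ->
  {for z, continuous (H : C^o -> C^o)}.
Proof. by move=> /derivable_caratheodory[D cD HE]; exact: caratheodory_continuous cD HE. Qed.

Lemma slopes_param (g : R -> C) (D : R -> C) x :
  {for x.2, continuous (D : R -> C^o)} ->
  (forall t, g t = g x.2 + (t - x.2)%:C%C * D t) ->
  slopes rc (fun y => g y.2) x (fun=> 0) (fun y => D y.2).
Proof.
move=> cD gE; split.
- exact: cst_continuous.
- apply: (@continuous_comp _ _ _ (fun y : R * R => y.2) (D : R -> C^o)); last exact: cD.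
  exact: cvg_snd.
- by move=> y; rewrite mulr0 addr0 gE.
Qed.

Lemma slopes_real x : slopes rc (fun y => y.1%:C%C) x (fun=> 1) (fun=> 0).
Proof.
split; [exact: cst_continuous|exact: cst_continuous|].
by move=> y; rewrite mulr0 mulr1 addr0 -rmorphD subrKC.
Qed.

Lemma slopes_addl (p : C) (G A B : R * R -> C) x :
  slopes rc G x A B -> slopes rc (fun y => p + G y) x A B.
Proof. by case=> cA cB GE; split => // y; rewrite GE !addrA. Qed.

Lemma slopes_mulr (p : C) (G A B : R * R -> C) x :
  slopes rc G x A B -> slopes rc (fun y => p * G y) x (fun y => p * A y) (fun y => p * B y).
Proof.
case=> cA cB GE; split => [||y]; last by rewrite GE; ring.
- by apply: (@cvgM C _ (nbhs x)); [exact: cvg_cst|exact: cA].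
- by apply: (@cvgM C _ (nbhs x)); [exact: cvg_cst|exact: cB].
Qed.

Lemma norm_circle_homotopy (r s t : R) (p : C) : `|p| < r%:C%C -> 0 <= s <= 1 ->
  `|p + s%:C%C * (circle r t - p)| <= r%:C%C.
Proof.
move=> pr /andP[s0 s1]; have r0 : 0 <= r by rewrite -ler0c; exact: le_trans (ltW pr).
have -> : p + s%:C%C * (circle r t - p) = (1 - s)%:C%C * p + s%:C%C * circle r t.
  by rewrite rmorphB; ring.
apply: le_trans (ler_normD _ _) _; rewrite !normrM normc_circle //.
have nr (k : R) : 0 <= k -> `|k%:C%C : C| = k%:C%C by rewrite -ler0c; exact: ger0_norm.
rewrite !nr ?subr_ge0 //.
have E : (1 - s)%:C%C * r%:C%C + s%:C%C * r%:C%C = r%:C%C :> C.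
  by rewrite rmorphB; ring.
rewrite -[leRHS]E lerD2r; apply: ler_wpM2l; last exact: ltW.
by rewrite ler0c subr_ge0.
Qed.

(** The circle of radius r is contracted to p along straight segments,
    zeta(s, t) = p + s (circle r t - p), and the closed form f(z) dz / (z - p)
    is pulled back to the rectangle [a, 1] x [0, 2 pi]. The hypothesis 0 < a
    keeps zeta away from the pole. *)
Lemma cauchy_homotopy (f : C -> C) (p : C) (r a : R) :
  `|p| < r%:C%C -> 0 < a <= 1 ->
  (forall z, `|z| <= r%:C%C -> derivable (f : C^o -> C^o) z 1) ->
  complex_integral 0 (2 * pi) (fun t => f (p + a%:C%C * (circle r t - p)) *
    ('i%C * circle r t / (circle r t - p))) =
  complex_integral 0 (2 * pi) (fun t => f (circle r t) *
    ('i%C * circle r t / (circle r t - p))).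
Proof.
move=> pr /andP[a0 a1] df.
have r0 : 0 <= r by rewrite -ler0c; apply: ltW; apply: le_lt_trans pr.
pose w t := circle r t - p.
have w0 t : w t != 0.
  apply/eqP => /subr0_eq E; move: pr.
  by rewrite -E normc_circle // ltxx.
have w_in (s t : R) := @norm_circle_homotopy r s t p pr.
pose zeta (y : R * R) := p + y.1%:C%C * w y.2.
pose H z := f z / (z - p).
have dH (y : R * R) : 0 < y.1 <= 1 -> derivable (H : C^o -> C^o) (zeta y) 1.
  move=> /andP[y0 y1].
  have z0 : zeta y - p != 0.
    rewrite /zeta addrC addKr mulf_neq0 //.
    by apply/eqP => -[] y10; rewrite y10 ltxx in y0.
  apply: derivableM; first by apply: df; apply: w_in; rewrite (ltW y0).
  apply: derivableV => //.
(* the coefficients H(zeta) d zeta / ds and H(zeta) d zeta / dt *)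
pose P y := H (zeta y) * w y.2.
pose Q y := H (zeta y) * (y.1%:C%C * ('i%C * circle r y.2)).
have QE (s t : R) : 0 < s -> Q (s, t) = f (p + s%:C%C * w t) * ('i%C * circle r t / w t).
  move=> s0; rewrite /Q /H /zeta /=.
  have s0' : s%:C%C != 0 :> C by apply/eqP => -[] y10; rewrite y10 ltxx in s0.
  by rewrite [p + _ - p]addrC addKr; field; rewrite w0 s0'.
have -> : complex_integral 0 (2 * pi) (fun t => f (p + a%:C%C * (circle r t - p)) *
    ('i%C * circle r t / (circle r t - p))) = complex_integral 0 (2 * pi) (fun t => Q (a, t)).
  by congr complex_integral; apply/funext => t; rewrite QE.
have -> : complex_integral 0 (2 * pi) (fun t => f (circle r t) *
    ('i%C * circle r t / (circle r t - p))) = complex_integral 0 (2 * pi) (fun t => Q (1, t)).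
  by congr complex_integral; apply/funext => t; rewrite QE ?ltr01 // mul1r /w subrKC.
apply: (@periodic_closed_complex_integral P) => //.
- by rewrite mulr_ge0 // pi_ge0.
- by move=> s; rewrite /P /zeta /w /circle cos0 sin0 mulr_natl cos2pi sin2pi.
move=> x [/andP[x1 x1'] _].
have x0 := lt_le_trans a0 x1.
have [E cE [Ex EE]] := circle_caratheodory r x.2.
have sw : slopes rc (fun y => w y.2) x (fun=> 0) (fun y => E y.2).
  by apply: slopes_param => // t; rewrite /w EE; ring.
have sc : slopes rc (fun y => circle r y.2) x (fun=> 0) (fun y => E y.2).
  exact: slopes_param.
have sz := slopes_addl p (slopesM (@continuous_real_complex) (slopes_real x) sw).
have [D cD DE] := derivable_caratheodory (dH x (introT andP (conj x0 x1'))).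
have sH := slopes_comp (@continuous_real_complex) sz cD DE.
have sP := slopesM (@continuous_real_complex) sH sw.
have sQ := slopesM (@continuous_real_complex) sH
  (slopesM (@continuous_real_complex) (slopes_real x) (slopes_mulr 'i%C sc)).
do 4 eexists; split; [exact: sP|exact: sQ|].
by rewrite /= Ex; ring.
Qed.

End Cauchy.

Section MeanValue.
Variable R : realType.
Local Notation C := (R[i]).
Implicit Types (g h : R -> C) (f : C -> C).

Definition circle_integral g : C := complex_integral 0 (2 * pi) g.
Local Notation L := circle_integral.

Let two_pi_ge0 : 0 <= 2 * pi :> R.
Proof. by rewrite mulr_ge0 // pi_ge0. Qed.

Lemma continuous_Re_segment a b g : continuous (g : R -> C^o) ->
  continuous_on_segment a b (fun t => complex.Re (g t)).
Proof.
move=> cg t _; apply: (@continuous_comp _ _ _ (g : R -> C^o) (@complex.Re R)).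
  exact: cg.
exact: continuous_Re.
Qed.

Lemma continuous_Im_segment a b g : continuous (g : R -> C^o) ->
  continuous_on_segment a b (fun t => complex.Im (g t)).
Proof.
move=> cg t _; apply: (@continuous_comp _ _ _ (g : R -> C^o) (@complex.Im R)).
  exact: cg.
exact: continuous_Im.
Qed.

Lemma circle_integralD g h : continuous (g : R -> C^o) -> continuous (h : R -> C^o) ->
  L (fun t => g t + h t) = L g + L h.
Proof.
move=> cg ch; rewrite /L /complex_integral [RHS]/=; congr (_ +i* _)%C.
- rewrite -segment_integralD; [|exact: continuous_Re_segment..].
  by apply: eq_segment_integral => t _; case: (g t) (h t) => a b [].
- rewrite -segment_integralD; [|exact: continuous_Im_segment..].
  by apply: eq_segment_integral => t _; case: (g t) (h t) => a b [].
Qed.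

Lemma circle_integralZ (c : C) g : continuous (g : R -> C^o) ->
  L (fun t => c * g t) = c * L g.
Proof.
move=> cg; rewrite /L /complex_integral; case: c => a b [:cR cI].
rewrite [RHS]/=; congr (_ +i* _)%C.
- rewrite -!segment_integralZ; first last.
  + abstract: cR; exact: continuous_Re_segment.
  + abstract: cI; exact: continuous_Im_segment.
  rewrite -segment_integralB; first last.
  + by move=> t tt; apply: cvgM; [exact: cvg_cst|exact: cI].
  + by move=> t tt; apply: cvgM; [exact: cvg_cst|exact: cR].
  by apply: eq_segment_integral => t _; case: (g t).
- rewrite -!segment_integralZ //.
  rewrite -segment_integralD; first last.
  + by move=> t tt; apply: cvgM; [exact: cvg_cst|exact: cR].
  + by move=> t tt; apply: cvgM; [exact: cvg_cst|exact: cI].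
  by apply: eq_segment_integral => t _; case: (g t).
Qed.

Lemma circle_integral_cst (c : C) : L (fun=> c) = c * (2 * pi)%:C%C.
Proof.
rewrite /L /complex_integral !segment_integral_cst //.
by case: c => a b; apply/eqP; rewrite eq_complex /= !subr0 !mulr0 add0r subr0 !eqxx.
Qed.

Lemma circle_integral_conj g : continuous (g : R -> C^o) ->
  L (fun t => (g t)^*) = (L g)^*.
Proof.
move=> cg; rewrite /L /complex_integral; apply/eqP; rewrite eq_complex.
apply/andP; split; apply/eqP => /=.
  by apply: eq_segment_integral => t _; case: (g t).
rewrite -mulN1r -segment_integralZ; last exact: continuous_Im_segment.
by apply: eq_segment_integral => t _; rewrite mulN1r; case: (g t).
Qed.

Lemma circle_integral_ge0 g : (forall t, 0 <= g t) -> 0 <= L g.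
Proof.
move=> g0; rewrite lecE /=.
rewrite (eq_segment_integral (g := fun=> 0)) => [|t _]; last by rewrite ger0_Im.
rewrite segment_integral_cst // mul0r eqxx /=; apply: segment_integral_ge0 => t.
by have := g0 t; rewrite lecE => /andP[].
Qed.

Lemma circle_integral_small (e : R) g : continuous (g : R -> C^o) ->
  (forall t, `|g t| <= e%:C%C) ->
  `|complex.Re (L g)| <= e * (2 * pi) /\ `|complex.Im (L g)| <= e * (2 * pi).
Proof.
move=> cg ge.
have ge' t : Normc.normc (g t) <= e by rewrite -lecR -norm_normcE.
rewrite -[2 * pi]subr0; split.
- apply: segment_integral_bound => //; first exact: continuous_Re_segment.
  by move=> x _; apply: le_trans (normc_geRe _) _.
- apply: segment_integral_bound => //; first exact: continuous_Im_segment.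
  by move=> x _; apply: le_trans (normc_geIm _) _.
Qed.

Lemma circle_integral_sum (I : Type) (s : seq I) (g : I -> R -> C) :
  (forall i, continuous (g i : R -> C^o)) ->
  continuous ((fun t => \sum_(i <- s) g i t) : R -> C^o) /\
  L (fun t => \sum_(i <- s) g i t) = \sum_(i <- s) L (g i).
Proof.
move=> cg; elim: s => [|i s [ihc ih]].
  have -> : (fun t => \sum_(i <- [::]) g i t) = (fun=> 0).
    by apply/funext => t; rewrite big_nil.
  by split; [exact: cst_continuous|rewrite circle_integral_cst mul0r big_nil].
have -> : (fun t => \sum_(j <- i :: s) g j t) =
    (fun t => g i t + \sum_(j <- s) g j t).
  by apply/funext => t; rewrite big_cons.
split; last by rewrite circle_integralD; [rewrite ih big_cons|exact: cg|exact: ihc].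
by move=> t; apply: (@cvgD C C^o _ (nbhs t)); [exact: cg|exact: ihc].
Qed.

Lemma eq0_small (x K : R) : 0 <= K -> (forall e, 0 < e -> `|x| <= e * K) -> x = 0.
Proof.
move=> K0 h; apply/eqP/negPn/negP => x0.
have /h : 0 < `|x| / (2 * (K + 1)) by rewrite divr_gt0 ?normr_gt0 //; lra.
have x0' : 0 < `|x| by rewrite normr_gt0.
rewrite mulrAC ler_pdivlMr; last by lra.
have := mulr_ge0 (normr_ge0 x) K0; nra.
Qed.

Lemma continuous_circle r : continuous (circle r : R -> C^o).
Proof.
move=> t; have [D cD [_ DE]] := circle_caratheodory r t.
have -> : circle r = (fun u => circle r t + (u - t)%:C%C * D u) by apply/funext.
apply: (@cvgD C C^o _ (nbhs t)); first exact: cvg_cst.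
apply: (@cvgM C _ (nbhs t)); last exact: cD.
apply: (@continuous_comp _ _ _ (fun u => u - t) (fun u : R => u%:C%C : C^o)).
  by apply: cvgB; [exact: cvg_id|exact: cvg_cst].
exact: continuous_real_complex.
Qed.

Lemma continuous_derivable_comp f (g : R -> C) : continuous (g : R -> C^o) ->
  (forall t, derivable (f : C^o -> C^o) (g t) 1) ->
  continuous (fun t => f (g t) : C^o).
Proof.
move=> cg df t; apply: (@continuous_comp _ _ _ (g : R -> C^o) (f : C^o -> C^o)).
  exact: cg.
exact: derivable_continuous.
Qed.

(** dz / (z - p) along the circle is 'i times this factor times dt. *)
Definition cauchy_factor (r : R) (p : C) t := circle r t / (circle r t - p).

Lemma circle_neq (r : R) (p : C) t : `|p| < r%:C%C -> circle r t - p != 0.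
Proof.
move=> pr; apply/eqP => /subr0_eq E; move: (pr).
by rewrite -E normc_circle ?ltxx // -ler0c; apply: le_trans (ltW pr).
Qed.

Lemma continuous_cauchy_factor r p : `|p| < r%:C%C ->
  continuous (cauchy_factor r p : R -> C^o).
Proof.
move=> pr t; rewrite /cauchy_factor.
apply: (@cvgM C _ (nbhs t)); first exact: continuous_circle.
apply: (@cvgV C R (nbhs t)); first exact: circle_neq.
apply: (@cvgB C C^o _ (nbhs t)); first exact: continuous_circle.
exact: cvg_cst.
Qed.

Lemma normr_cauchy_factor r p t : `|p| < r%:C%C ->
  `|cauchy_factor r p t| <= r%:C%C / (r%:C%C - `|p|).
Proof.
move=> pr; have r0 : 0 <= r by rewrite -ler0c; apply: le_trans (ltW pr).
rewrite normrM normc_circle // ler_wpM2l ?ler0c // normfV.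
rewrite lef_pV2 ?posrE ?subr_gt0 // ?normr_gt0 ?circle_neq //.
by rewrite -(normc_circle t r0); exact: lerB_dist.
Qed.

(** By the homotopy the integral on the left does not change when the circle is
    contracted towards p, where f tends to f p by continuity. *)
Lemma cauchy_formula_factor f (r : R) (p : C) :
  `|p| < r%:C%C -> (forall z, `|z| <= r%:C%C -> derivable (f : C^o -> C^o) z 1) ->
  L (fun t => f (circle r t) * cauchy_factor r p t) =
  f p * L (cauchy_factor r p).
Proof.
move=> pr df; have r0 : 0 < r by rewrite -ltcR; exact: le_lt_trans (normr_ge0 p) pr.
have ck := continuous_cauchy_factor pr.
have w_in (a : R) t : 0 < a <= 1 -> `|p + a%:C%C * (circle r t - p)| <= r%:C%C.
  by move=> /andP[a0 a1]; apply: norm_circle_homotopy => //; rewrite (ltW a0).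
pose F (a : R) t := f (p + a%:C%C * (circle r t - p)).
have cF a : 0 < a <= 1 -> continuous (F a : R -> C^o).
  move=> a01; apply: continuous_derivable_comp => [t|t]; last by apply: df; exact: w_in.
  apply: (@cvgD C C^o _ (nbhs t)); first exact: cvg_cst.
  apply: (@cvgM C _ (nbhs t)); first exact: cvg_cst.
  apply: (@cvgB C C^o _ (nbhs t)); first exact: continuous_circle.
  exact: cvg_cst.
have cFk a : 0 < a <= 1 -> continuous ((fun t => F a t * cauchy_factor r p t) : R -> C^o).
  by move=> a01 t; apply: (@cvgM C _ (nbhs t)); [exact: cF|exact: ck].
have homotopy a : 0 < a <= 1 -> L (fun t => F a t * cauchy_factor r p t) =
    L (fun t => f (circle r t) * cauchy_factor r p t).
  move=> a01; have i0 : 'i%C != 0 :> C by rewrite eq_complex /= oner_eq0 andbF.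
  apply: (mulfI i0); have c1 := cFk a a01.
  have := cFk 1 _; rewrite lexx ltr01 => /(_ isT) c2.
  have F1 t : F 1 t = f (circle r t) by rewrite /F mul1r subrKC.
  have -> : (fun t => f (circle r t) * cauchy_factor r p t) =
    (fun t => F 1 t * cauchy_factor r p t) by apply/funext => t; rewrite F1.
  rewrite -!circle_integralZ //.
  have := cauchy_homotopy pr a01 df.
  rewrite /L /F /cauchy_factor => E.
  have -> : (fun t => 'i%C * (f (p + a%:C%C * (circle r t - p)) *
      (circle r t / (circle r t - p)))) =
    (fun t => f (p + a%:C%C * (circle r t - p)) * ('i%C * circle r t / (circle r t - p))).
    by apply/funext => t; ring.
  rewrite E; congr complex_integral; apply/funext => t.
  by rewrite mul1r subrKC; ring.
pose M := r / (r - Normc.normc p).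
have pr' : Normc.normc p < r by rewrite -ltcR -norm_normcE.
have M0 : 0 < M by rewrite divr_gt0 ?subr_gt0.
have kM t : `|cauchy_factor r p t| <= M%:C%C.
  apply: le_trans (normr_cauchy_factor _ pr) _.
  by rewrite norm_normcE -rmorphB -fmorphV -rmorphM.
pose Delta := L (fun t => f (circle r t) * cauchy_factor r p t) -
  f p * L (cauchy_factor r p).
have small e : 0 < e -> `|complex.Re Delta| <= e * (M * (2 * pi)) /\
    `|complex.Im Delta| <= e * (M * (2 * pi)).
  move=> e0; have cf := derivable_continuous (df p (ltW pr)).
  have e0' : 0 < e%:C%C :> C by rewrite ltcR.
  have : nbhs (p : C^o) [set z | `|f p - f z| <= e%:C%C].
    exact: (@cvgrPdist_le _ _ _ (nbhs (p : C^o)) _ (f : C^o -> C^o) (f p)).1 cf _ e0'.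
  move=> /nbhs_ballP[d /= d0 near_p].
  have [a a01 ad] : exists2 a : R, 0 < a <= 1 & (a * (2 * r))%:C%C < d.
    move: d0; case: (d) => d1 d2; rewrite ltcE /= => /andP[/eqP -> d10].
    exists (Num.min 1 (d1 / (4 * r))).
      rewrite lt_min ltr01 ge_min lexx /= andbT divr_gt0 //; lra.
    rewrite ltcE /= eqxx /=.
    have : Num.min 1 (d1 / (4 * r)) <= d1 / (4 * r) by rewrite ge_min lexx orbT.
    rewrite ler_pdivlMr; last by lra.
    by set m := Num.min _ _ => h; lra.
  have Fd t : `|F a t - f p| <= e%:C%C.
    rewrite distrC; apply: near_p; rewrite /ball /= opprD addrA subrr add0r normrN.
    apply: le_lt_trans ad; rewrite normrM rmorphM.
    have a0 : 0 <= a by case/andP: a01 => /ltW.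
    rewrite ger0_norm ?ler0c // ler_wpM2l ?ler0c //.
    apply: le_trans (ler_normB _ _) _; rewrite normc_circle ?(ltW r0) //.
    by rewrite mulr_natl rmorphMn mulr2n lerD2l ltW.
  have -> : Delta = L (fun t => (F a t - f p) * cauchy_factor r p t).
    rewrite /Delta -(homotopy a a01) -mulNr -circle_integralZ // -circle_integralD.
    - by congr circle_integral; apply/funext => t; rewrite mulrBl mulNr.
    - exact: cFk.
    - by move=> t; apply: (@cvgM C _ (nbhs t)); [exact: cvg_cst|exact: ck].
  rewrite (mulrA e); apply: (@circle_integral_small (e * M)).
    move=> t; apply: (@cvgM C _ (nbhs t)); last exact: ck.
    by apply: (@cvgB C C^o _ (nbhs t)); [exact: cF|exact: cvg_cst].
  move=> t; rewrite normrM rmorphM; apply: ler_pM => //.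
have K0 : 0 <= M * (2 * pi) by rewrite mulr_ge0 // ltW.
apply/eqP; rewrite -subr_eq0 -/Delta eq_complex; apply/andP; split; apply/eqP.
- by apply: eq0_small K0 _ => e /small[].
- by apply: eq0_small K0 _ => e /small[].
Qed.

End MeanValue.

(** * Szego kernels and the necessity of Pick's condition *)

Section Necessity.
Variable R : realType.
Local Notation C := (R[i]).
Implicit Types (r : R) (f : C -> C) (p : C).
Local Notation L := (@circle_integral R).

Lemma continuous_conj : continuous (fun u : C^o => u^* : C^o).
Proof.
move=> u; apply/(@cvgrPdist_lt _ _ _ (nbhs (u : C^o))) => e e0.
near=> v; rewrite -rmorphB norm_conjC.
by near: v; exact: (nbhsx_ballx (u : C^o) e e0).
Unshelve. all: by end_near. Qed.

(** The Szego kernel of the disc of radius r; on the circle its conjugate is the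
    Cauchy factor of p. *)
Definition szego r p (z : C) : C := (1 - p^* * z / r%:C%C ^+ 2)^-1.

Lemma szego_denominator r p z : `|p| < r%:C%C -> `|z| <= r%:C%C ->
  1 - p^* * z / r%:C%C ^+ 2 != 0.
Proof.
move=> pr zr; have r0 : 0 < r%:C%C :> C := le_lt_trans (normr_ge0 p) pr.
rewrite subr_eq0; apply/eqP => E.
have : `|p^* * z / r%:C%C ^+ 2| < 1.
  rewrite normrM normfV normrX (gtr0_norm r0) ltr_pdivrMr ?exprn_gt0 // mul1r.
  rewrite normrM norm_conjC expr2.
  apply: (@le_lt_trans _ _ (`|p| * r%:C%C)); first exact: ler_wpM2l.
  by rewrite ltr_pM2r.
by rewrite -E normr1 ltxx.
Qed.

Lemma derivable_szego r p z : `|p| < r%:C%C -> `|z| <= r%:C%C ->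
  derivable (szego r p : C^o -> C^o) z 1.
Proof.
move=> pr zr; apply: derivableV; first exact: szego_denominator.
have -> : (fun y : C^o => 1 - p^* * y / r%:C%C ^+ 2) =
    cst 1 - (cst (p^* / r%:C%C ^+ 2) * id) :> (C^o -> C^o).
  by apply/funext => y; rewrite /= mulrAC.
by apply: derivableB => //; apply: derivableM.
Qed.

Lemma szego_circle r p t : `|p| < r%:C%C ->
  (szego r p (circle r t))^* = cauchy_factor r p t.
Proof.
move=> pr; have r0 : 0 < r%:C%C :> C := le_lt_trans (normr_ge0 p) pr.
have r0' : 0 <= r by rewrite -ler0c ltW.
have cc : circle r t * (circle r t)^* = r%:C%C ^+ 2.
  by rewrite -normCK normc_circle.
have c0 : circle r t != 0.
  by rewrite -normr_gt0 normc_circle.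
have ccE : (circle r t)^* = r%:C%C ^+ 2 / circle r t.
  by rewrite -cc mulrAC mulfV ?mul1r.
have rJ : (r%:C%C ^+ 2)^* = r%:C%C ^+ 2 :> C.
  by rewrite rmorphXn /= conj_Creal // realE ltW.
rewrite /szego /cauchy_factor fmorphV rmorphB rmorph1 !rmorphM /= conjCK fmorphV /= rJ.
have cp := circle_neq t pr.
rewrite ccE; have r2 : r%:C%C != 0 :> C by rewrite gt_eqF.
by field; rewrite c0 r2 cp.
Qed.

Lemma continuous_szego_circle r p : `|p| < r%:C%C ->
  continuous ((fun t => szego r p (circle r t)) : R -> C^o).
Proof.
move=> pr; have r0 : 0 <= r by rewrite -ler0c; apply: le_trans (ltW pr).
apply: continuous_derivable_comp; first exact: continuous_circle.
by move=> t; apply: derivable_szego => //; rewrite normc_circle.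
Qed.

(** The Cauchy factor is the conjugate of the Szego kernel, which is holomorphic
    with value 1 at the origin; so the mean value property, the case p = 0 of
    [cauchy_formula_factor], computes its integral. *)
Lemma circle_integral_cauchy_factor r p : `|p| < r%:C%C ->
  L (cauchy_factor r p) = (2 * pi)%:C%C.
Proof.
move=> pr; have r0 : 0 < r by rewrite -ltcR; exact: le_lt_trans (normr_ge0 p) pr.
have -> : cauchy_factor r p = (fun t => (szego r p (circle r t))^*).
  by apply/funext => t; rewrite szego_circle.
rewrite circle_integral_conj; last exact: continuous_szego_circle.
have o0 : `|0 : C| < r%:C%C by rewrite normr0 ltcR.
have k0 : cauchy_factor r 0 = (fun=> 1).
  apply/funext => t; rewrite /cauchy_factor subr0 divff //.
  by have := circle_neq t o0; rewrite subr0.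
have := @cauchy_formula_factor _ (szego r p) r 0 o0 (fun z => @derivable_szego r p z pr).
rewrite k0 circle_integral_cst /szego mulr0 mul0r subr0 invr1 !mul1r.
have -> : (fun t => (1 - p^* * circle r t / r%:C%C ^+ 2)^-1 * 1) =
  (fun t => szego r p (circle r t)) by apply/funext => t; rewrite mulr1.
by move=> ->; rewrite conj_Creal // complex_real.
Qed.

(** The reproducing property of the Szego kernel. *)
Lemma cauchy_formula f r p : `|p| < r%:C%C ->
  (forall z, `|z| <= r%:C%C -> derivable (f : C^o -> C^o) z 1) ->
  L (fun t => f (circle r t) * (szego r p (circle r t))^*) = f p * (2 * pi)%:C%C.
Proof.
move=> pr df; rewrite -(circle_integral_cauchy_factor pr) -cauchy_formula_factor //.
by congr circle_integral; apply/funext => t; rewrite szego_circle.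
Qed.

Section Kernel.
Variables (n : nat) (r : R) (z : 'I_n -> C).
Hypothesis zr : forall i, `|z i| < r%:C%C.

Definition szego_span (d : 'I_n -> C) (u : C) : C := \sum_j d j * szego r (z j) u.

Lemma derivable_szego_span d u : `|u| <= r%:C%C ->
  derivable (szego_span d : C^o -> C^o) u 1.
Proof.
move=> ur.
have -> : szego_span d = \sum_j (cst (d j) * (szego r (z j) : C^o -> C^o)) :> (C^o -> C^o).
  by apply/funext => v; rewrite /szego_span fct_sumE.
apply: derivable_sum => j; apply: derivableM; first exact: derivable_cst.
exact: derivable_szego.
Qed.

Lemma szego_span_pairing (phi : C -> C) (d : 'I_n -> C) :
  (forall u, `|u| <= r%:C%C -> derivable (phi : C^o -> C^o) u 1) ->
  0 <= r ->
  L (fun t => phi (circle r t) * (szego_span d (circle r t))^*) =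
  (\sum_j (d j)^* * phi (z j)) * (2 * pi)%:C%C.
Proof.
move=> dphi r0; have cr t : `|circle r t| <= r%:C%C by rewrite normc_circle.
pose G j t := (d j)^* * (phi (circle r t) * (szego r (z j) (circle r t))^*).
have cK j : continuous ((fun t => phi (circle r t) * (szego r (z j) (circle r t))^*) : R -> C^o).
  move=> t; apply: (@cvgM C _ (nbhs t)).
    apply: continuous_derivable_comp; first exact: continuous_circle.
    by move=> u; apply: dphi.
  have -> : (fun t => (szego r (z j) (circle r t))^*) = cauchy_factor r (z j).
    by apply/funext => u; rewrite szego_circle.
  by rewrite szego_circle //; exact: continuous_cauchy_factor.
have cG j : continuous (G j : R -> C^o).
  by move=> t; apply: (@cvgM C _ (nbhs t)); [exact: cvg_cst|exact: cK].
have -> : (fun t => phi (circle r t) * (szego_span d (circle r t))^*) =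
    (fun t => \sum_j G j t).
  apply/funext => t; rewrite /szego_span rmorph_sum mulr_sumr.
  by apply: eq_bigr => j _; rewrite /G rmorphM mulrCA.
rewrite (circle_integral_sum _ cG).2 mulr_suml; apply: eq_bigr => j _.
by rewrite circle_integralZ // cauchy_formula // mulrA.
Qed.

(** With h = sum c_j k_j and g = sum c_j conj(w_j) k_j for the kernels k_j of the
    nodes, the reproducing property gives <f g, h> = <g, g>. Hence
    0 <= |h - f g|^2 = |h|^2 - 2 |g|^2 + |f g|^2 <= |h|^2 - |g|^2 in the norm of
    L^2 of the circle, and the right-hand side is the Pick form. *)
Lemma pick_form_radius_ge0 f (c : 'I_n -> C) : 0 <= r ->
  (forall u, `|u| <= r%:C%C -> derivable (f : C^o -> C^o) u 1) ->
  (forall u, `|u| <= r%:C%C -> `|f u| <= 1) ->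
  0 <= \sum_i \sum_j (c i)^* * c j * (1 - f (z i) * (f (z j))^*) * szego r (z j) (z i).
Proof.
move=> r0 df f1.
have cr t : `|circle r t| <= r%:C%C by rewrite normc_circle.
pose w j := f (z j).
pose d j := c j * (w j)^*.
pose h u := szego_span c u; pose g u := szego_span d u.
pose hc t := h (circle r t); pose gc t := g (circle r t); pose F t := f (circle r t).
have dh u : `|u| <= r%:C%C -> derivable (h : C^o -> C^o) u 1 by exact: derivable_szego_span.
have dg u : `|u| <= r%:C%C -> derivable (g : C^o -> C^o) u 1 by exact: derivable_szego_span.
have ch : continuous (hc : R -> C^o).
  by apply: continuous_derivable_comp; [exact: continuous_circle|move=> t; exact: dh].
have cg : continuous (gc : R -> C^o).
  by apply: continuous_derivable_comp; [exact: continuous_circle|move=> t; exact: dg].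
have cF : continuous (F : R -> C^o).
  by apply: continuous_derivable_comp; [exact: continuous_circle|move=> t; exact: df].
have cM (u v : R -> C) : continuous (u : R -> C^o) -> continuous (v : R -> C^o) ->
    continuous ((fun t => u t * v t) : R -> C^o).
  by move=> cu cv t; apply: (@cvgM C _ (nbhs t)); [exact: cu|exact: cv].
have cD (u v : R -> C) : continuous (u : R -> C^o) -> continuous (v : R -> C^o) ->
    continuous ((fun t => u t + v t) : R -> C^o).
  by move=> cu cv t; apply: (@cvgD C C^o _ (nbhs t)); [exact: cu|exact: cv].
have cJ (u : R -> C) : continuous (u : R -> C^o) -> continuous ((fun t => (u t)^*) : R -> C^o).
  by move=> cu t; apply: (continuous_comp (cu t)); exact: continuous_conj.
pose two_pi : C := (2 * pi)%:C%C.
have Lhh : L (fun t => hc t * (hc t)^*) = (\sum_j (c j)^* * h (z j)) * two_pi.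
  exact: szego_span_pairing.
have Lgg : L (fun t => gc t * (gc t)^*) = (\sum_j (d j)^* * g (z j)) * two_pi.
  exact: szego_span_pairing.
have Lfgh : L (fun t => F t * gc t * (hc t)^*) = L (fun t => gc t * (gc t)^*).
  have dfg u : `|u| <= r%:C%C -> derivable ((fun u => f u * g u) : C^o -> C^o) u 1.
    by move=> ur; apply: derivableM; [exact: df|exact: dg].
  have E := szego_span_pairing c dfg r0.
  rewrite Lgg; apply: etrans E _; congr (_ * _); apply: eq_bigr => j _.
  by rewrite /d rmorphM /= conjCK mulrA.
pose X := L (fun t => gc t * (gc t)^*).
have cFg := cM _ _ cF cg; have chJ := cJ _ ch; have cgJ := cJ _ cg.
have cgg := cM _ _ cg cgJ; have chh := cM _ _ ch chJ.
have cFgh := cM _ _ cFg chJ; have chFg := cM _ _ ch (cJ _ cFg).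
have XJ : X^* = X.
  rewrite /X -(circle_integral_conj cgg); congr circle_integral; apply/funext => t.
  by rewrite rmorphM /= conjCK mulrC.
have Lhfg : L (fun t => hc t * (F t * gc t)^*) = X.
  rewrite -XJ /X -Lfgh -(circle_integral_conj cFgh).
  by congr circle_integral; apply/funext => t; rewrite !rmorphM /= conjCK mulrC.
have cB (u v : R -> C) : continuous (u : R -> C^o) -> continuous (v : R -> C^o) ->
    continuous ((fun t => u t - v t) : R -> C^o).
  by move=> cu cv t; apply: (@cvgB C C^o _ (nbhs t)); [exact: cu|exact: cv].
have cE := cB _ _ ch cFg.
pose S1 t := (hc t - F t * gc t) * (hc t - F t * gc t)^*.
pose S2 t := (1 - F t * (F t)^*) * (gc t * (gc t)^*).
have c1F : continuous ((fun t => 1 - F t * (F t)^*) : R -> C^o).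
  by apply: (cB (fun=> 1)); [exact: cst_continuous|exact: cM cF (cJ _ cF)].
have cS1 : continuous (S1 : R -> C^o) := cM _ _ cE (cJ _ cE).
have cS2 : continuous (S2 : R -> C^o) := cM _ _ c1F cgg.
have S10 : 0 <= L S1 by apply: circle_integral_ge0 => t; exact: mul_conjC_ge0.
have S20 : 0 <= L S2.
  apply: circle_integral_ge0 => t; apply: mulr_ge0; last exact: mul_conjC_ge0.
  rewrite subr_ge0 -normCK; apply: exprn_ile1 => //; exact: f1.
have expand : L (fun t => hc t * (hc t)^*) + X = L S1 + L S2 + X + X.
  have E : L (fun t => hc t * (hc t)^* + gc t * (gc t)^*) =
      L (fun t => S1 t + S2 t + F t * gc t * (hc t)^* + hc t * (F t * gc t)^*).
    by congr circle_integral; apply/funext => t; rewrite /S1 /S2 rmorphB !rmorphM /=; ring.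
  move: E; rewrite (circle_integralD chh cgg).
  rewrite (circle_integralD (cD _ _ (cD _ _ cS1 cS2) cFgh) chFg).
  rewrite (circle_integralD (cD _ _ cS1 cS2) cFgh) (circle_integralD cS1 cS2).
  by rewrite Lfgh Lhfg.
have : 0 <= L (fun t => hc t * (hc t)^*) - X.
  have -> : L (fun t => hc t * (hc t)^*) - X = L S1 + L S2.
    by apply/eqP; rewrite subr_eq; apply/eqP; apply: (addIr X); rewrite expand.
  exact: addr_ge0.
rewrite Lhh /X Lgg -mulrBl -sumrB pmulr_lge0; last first.
  by rewrite /two_pi ltcR mulr_gt0 // pi_gt0.
congr (0 <= _); apply: eq_bigr => i _.
rewrite /h /g /szego_span !mulr_sumr -sumrB; apply: eq_bigr => j _.
by rewrite /d !rmorphM /= !conjCK -/(w i) -/(w j); ring.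
Qed.

End Kernel.

End Necessity.

Section PickNecessity.
Variable R : realType.
Local Notation C := (R[i]).

Lemma cvg_szego_radius (p u : C) : `|p| < 1 -> `|u| < 1 ->
  szego r p u @[r --> (1 : R)] --> ((1 - u * p^*)^-1 : C^o).
Proof.
move=> p1 u1; rewrite [u * _]mulrC.
have one : 1%:C%C = 1 :> C by [].
have -> : 1 - p^* * u = 1 - p^* * u / 1%:C%C ^+ 2 by rewrite one expr1n divr1.
have c : {for (1 : R), continuous (fun r : R => r%:C%C : C^o)}.
  exact: continuous_real_complex.
rewrite /szego; apply: (@cvgV C R (nbhs (1 : R))).
  by apply: szego_denominator => //; exact: ltW.
apply: (@cvgB C C^o _ (nbhs (1 : R))); first exact: cvg_cst.
apply: (@cvgM C _ (nbhs (1 : R))); first exact: cvg_cst.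
apply: (@cvgV C R (nbhs (1 : R))); first by rewrite one expr1n oner_eq0.
by apply: (@cvgM C _ (nbhs (1 : R))); exact: c.
Qed.

Lemma complex_cvg_ge0 (F : set_system R) (Q : R -> C) (l : C) : ProperFilter F ->
  Q @ F --> (l : C^o) -> (\forall r \near F, 0 <= Q r) -> 0 <= l.
Proof.
move=> FF Ql Q0.
have cRe : (fun r => complex.Re (Q r)) @ F --> complex.Re l.
  exact: (cvg_comp Q _ Ql (@continuous_Re R l)).
have cIm : (fun r => complex.Im (Q r)) @ F --> complex.Im l.
  exact: (cvg_comp Q _ Ql (@continuous_Im R l)).
have Re0 : 0 <= complex.Re l.
  by apply: (cvgr_to_ge cRe); apply: filterS Q0 => r; rewrite lecE => /andP[].
have Im0 : 0 <= complex.Im l.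
  apply: (cvgr_to_ge cIm); apply: filterS Q0 => r; rewrite lecE => /andP[/eqP + _].
  by move=> ->.
have Im0' : complex.Im l <= 0.
  apply: (cvgr_to_le cIm); apply: filterS Q0 => r; rewrite lecE => /andP[/eqP + _].
  by move=> ->.
by rewrite lecE Re0 andbT; apply/eqP/le_anti; rewrite Im0 Im0'.
Qed.

Lemma complex_cvg_sum (F : set_system R) (I : Type) (s : seq I) (g : I -> R -> C)
    (l : I -> C) : Filter F ->
  (forall i, g i r @[r --> F] --> (l i : C^o)) ->
  (\sum_(i <- s) g i r) @[r --> F] --> ((\sum_(i <- s) l i) : C^o).
Proof.
move=> FF gl; elim: s => [|i s ih].
  rewrite big_nil.
  have -> : (fun r => \sum_(i <- [::]) g i r) = (fun=> 0).
    by apply/funext => r; rewrite big_nil.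
  exact: (@cvg_cst C^o 0 R F FF).
rewrite big_cons.
have -> : (fun r => \sum_(j <- i :: s) g j r) = (fun r => g i r + \sum_(j <- s) g j r).
  by apply/funext => r; rewrite big_cons.
exact: (@cvgD C C^o _ F FF (g i : R -> C^o) _ _ _ (gl i) ih).
Qed.

(** On the circles of radius r < 1 the function is holomorphic up to the boundary;
    the kernels of these circles tend to that of the unit disc as r tends to 1. *)
Theorem pick_necessity (f : C -> C) n (z : 'I_n -> C) (c : 'I_n -> C) :
  holomorphic_on (@unit_disc R) f -> (forall u, `|u| < 1 -> `|f u| <= 1) ->
  (forall i, `|z i| < 1) ->
  0 <= \sum_i \sum_j (c i)^* * c j * ((1 - f (z i) * (f (z j))^*) / (1 - z i * (z j)^*)).
Proof.
move=> df f1 z1.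
pose Q (r : R) := \sum_i \sum_j (c i)^* * c j * (1 - f (z i) * (f (z j))^*) *
  szego r (z j) (z i).
apply: (@complex_cvg_ge0 ((1 : R)^'-) Q).
  apply: (@cvg_within_filter _ _ _ (nbhs (1 : R))).
  apply: (@complex_cvg_sum (nbhs (1 : R))) => i.
  apply: (@complex_cvg_sum (nbhs (1 : R))) => j.
  rewrite mulrA; apply: (@cvgM C _ (nbhs (1 : R))); first exact: cvg_cst.
  exact: cvg_szego_radius.
near=> r.
have r1 : r < 1 by near: r; exact: nbhs_left_lt.
have r0 : 0 <= r by apply: ltW; near: r; apply: nbhs_left_gt; exact: ltr01.
have in_disc (u : C) : `|u| <= r%:C%C -> `|u| < 1.
  by move=> ur; apply: le_lt_trans ur _; rewrite -[1]/(1%:C)%C ltcR.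
apply: pick_form_radius_ge0 => //.
- move=> i; rewrite norm_normcE ltcR; move: i; near: r; apply: filter_forall => i.
  by apply: nbhs_left_gt; rewrite -ltcR -norm_normcE.
- by move=> u ur; apply: df; exact: in_disc.
- by move=> u ur; apply: f1; exact: in_disc.
Unshelve. all: by end_near. Qed.

End PickNecessity.

(** * Perturbation of positive semidefinite forms *)

Section QuadraticForms.
Variable R : realType.
Local Notation C := (R[i]).

Lemma ge0_complexE (c : C) : 0 <= c -> c = (complex.Re c)%:C%C.
Proof. by move=> c0; rewrite RRe_real // ger0_real. Qed.

Definition quadratic_form n (A : 'I_n -> 'I_n -> C) (c : 'I_n -> C) : C :=
  \sum_i \sum_j (c i)^* * c j * A i j.

Lemma quadratic_formD n (A : 'I_n -> 'I_n -> C) (u v : 'I_n -> C) (k : C) :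
  (forall i j, A j i = (A i j)^*) ->
  let beta := \sum_i \sum_j (u i)^* * v j * A i j in
  quadratic_form A (fun i => k * u i + v i) =
  k * k^* * quadratic_form A u + k^* * beta + k * beta^* + quadratic_form A v.
Proof.
move=> Ah /=.
have -> : (\sum_i \sum_j (u i)^* * v j * A i j)^* = \sum_i \sum_j (v i)^* * u j * A i j.
  rewrite rmorph_sum exchange_big /=; apply: eq_bigr => i _.
  rewrite rmorph_sum; apply: eq_bigr => j _.
  by rewrite !rmorphM /= conjCK -Ah; ring.
rewrite /quadratic_form !mulr_sumr -!big_split /=; apply: eq_bigr => i _.
rewrite !mulr_sumr -!big_split /=; apply: eq_bigr => j _.
by rewrite rmorphD rmorphM /=; ring.
Qed.

(** Cauchy-Schwarz for the form against the column b of the inverse matrix, whose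
    product with v under the form is the coordinate v k. Adding 1 to the factor
    spares the case where the form vanishes at b. *)
Lemma quadratic_form_coordinate n (A : 'I_n -> 'I_n -> C) (b : 'I_n -> C) (k : 'I_n) :
  (forall i j, A j i = (A i j)^*) -> (forall c, 0 <= quadratic_form A c) ->
  (forall i, \sum_j A i j * b j = (i == k)%:R) ->
  forall v, `|v k| ^+ 2 <= (quadratic_form A b + 1) * quadratic_form A v.
Proof.
move=> Ah A0 Ab v; set K := quadratic_form A b + 1.
have K0 : 0 < K by rewrite ltr_wpDl // ltr01.
have Ki : K \is Num.real by rewrite gtr0_real.
have bv : \sum_i \sum_j (b i)^* * v j * A i j = v k.
  have col j : \sum_i (b i)^* * v j * A i j = v j * (j == k)%:R.
    rewrite -(conjC_nat _ (j == k)) -Ab rmorph_sum mulr_sumr; apply: eq_bigr => i _.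
    by rewrite rmorphM /= -Ah; ring.
  rewrite exchange_big /= (bigD1 k) //= col eqxx mulr1 big1 ?addr0 // => j jk.
  by rewrite col (negPf jk) mulr0.
(* with factor quadratic_form A b in place of K this would be the minimizer *)
have := A0 (fun i => - (v k / K) * b i + v i).
rewrite quadratic_formD // bv rmorphN rmorphM fmorphV /= (conj_Creal Ki).
have K0' : K != 0 by rewrite gt_eqF.
have -> : - (v k / K) * - ((v k)^* / K) * quadratic_form A b +
    - ((v k)^* / K) * v k + - (v k / K) * (v k)^* + quadratic_form A v =
  quadratic_form A v - v k * (v k)^* / K - v k * (v k)^* / K ^+ 2.
  have -> : quadratic_form A b = K - 1 by rewrite /K addrK.
  by field.
move=> h; rewrite normCK -ler_pdivrMl // mulrC -subr_ge0.
apply: le_trans h _; rewrite lerBlDr lerDl divr_ge0 ?mul_conjC_ge0 //.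
by rewrite exprn_ge0 // ltW.
Qed.

(** An invertible positive semidefinite form bounds all coordinates, hence
    dominates a multiple of any other form. *)
Lemma quadratic_form_perturb n (A T : 'I_n -> 'I_n -> C) :
  (forall i j, A j i = (A i j)^*) -> (forall c, 0 <= quadratic_form A c) ->
  (forall c, 0 <= quadratic_form T c) ->
  \det (\matrix_(i, j) A i j) != 0 ->
  exists2 e : R, 0 < e & forall c, e%:C%C * quadratic_form T c <= quadratic_form A c.
Proof.
move=> Ah A0 T0 dA; pose M := \matrix_(i, j) A i j.
have Mu : M \in unitmx by rewrite unitmxE unitfE.
pose b k j := invmx M j k.
have Ab k i : \sum_j A i j * b k j = (i == k)%:R.
  have := mulmxV Mu => /matrixP /(_ i k); rewrite !mxE => <-.
  by apply: eq_bigr => j _; rewrite mxE.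
pose K k := quadratic_form A (b k) + 1.
have K1 k : 0 <= K k by rewrite addr_ge0.
have coord k v := quadratic_form_coordinate Ah A0 (Ab k) v.
pose N : C := \sum_i \sum_j `|T i j| * (K i + K j).
have N0 : 0 <= N.
  by apply: sumr_ge0 => i _; apply: sumr_ge0 => j _; rewrite mulr_ge0 // addr_ge0.
have TN v : quadratic_form T v <= N * quadratic_form A v.
  rewrite -(ger0_norm (T0 v)); apply: le_trans (ler_norm_sum _ _ _) _.
  rewrite mulr_suml; apply: ler_sum => i _; apply: le_trans (ler_norm_sum _ _ _) _.
  rewrite mulr_suml; apply: ler_sum => j _.
  rewrite normrM normrM norm_conjC mulrC -mulrA; apply: ler_wpM2l => //.
  rewrite mulrDl; apply: (@le_trans _ _ (`|v i| ^+ 2 + `|v j| ^+ 2)); last first.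
    by apply: lerD; exact: coord.
  have h : 0 <= (`|v i| - `|v j|) ^+ 2.
    by apply: real_exprn_even_ge0 => //; rewrite rpredB // normr_real.
  have h2 : 0 <= `|v i| * `|v j| by rewrite mulr_ge0.
  rewrite -subr_ge0.
  have -> : `|v i| ^+ 2 + `|v j| ^+ 2 - `|v i| * `|v j| =
    (`|v i| - `|v j|) ^+ 2 + `|v i| * `|v j| by ring.
  exact: addr_ge0.
have NE := ge0_complexE N0.
have n0 : 0 <= complex.Re N by rewrite -ler0c -NE.
exists (complex.Re N + 1)^-1; first by rewrite invr_gt0 ltr_wpDl.
move=> v; have N10 : 0 < N + 1 by rewrite ltr_wpDl // ltr01.
rewrite fmorphV rmorphD /= -NE rmorph1 mulrC ler_pdivrMr //.
apply: le_trans (TN v) _; rewrite mulrC; apply: ler_wpM2l => //.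
by rewrite lerDl ler01.
Qed.

End QuadraticForms.

(** * The largest admissible scale *)

Section PickThreshold.
Variables (R : realType) (n : nat) (z : 'I_n -> R[i]) (alpha : 'rV[R[i]]_n).
Hypotheses (z1 : forall i, `|z i| < 1) (z_inj : injective z).
Local Notation C := (R[i]).
Implicit Types (x s : R) (c : 'I_n -> C).

Definition scaled_value x i : C := x%:C%C * alpha 0 i.
Local Notation w := scaled_value.

Definition pick_admissible : set R :=
  [set x | 0 <= x /\ forall c, 0 <= pick_form z (w x) c].

Lemma psdmx_quadratic_form (A : 'M[C]_n) :
  psdmx A <-> forall c, 0 <= quadratic_form (fun i j => A i j) c.
Proof.
have E (v : 'cV[C]_n) : ((v ^t*)%sesqui *m A *m v) 0 0 =
    quadratic_form (fun i j => A i j) (fun i => v i 0).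
  rewrite mxE; under eq_bigr => j _ do rewrite mxE mulr_suml.
  rewrite exchange_big; apply: eq_bigr => i _; apply: eq_bigr => j _.
  by rewrite !mxE; ring.
split=> [psdA c|qA v]; last by rewrite E.
have := psdA (\col_i c i); rewrite E; congr (0 <= _).
by rewrite /quadratic_form; apply: eq_bigr => i _; apply: eq_bigr => j _; rewrite !mxE.
Qed.

Lemma conj_real_complex (x : R) : (x%:C%C : C)^* = x%:C%C.
Proof. by rewrite conj_Creal // complex_real. Qed.

Lemma pick_matrixE x i j :
  pick_matrix z alpha x i j = (1 - w x i * (w x j)^*) / (1 - z i * (z j)^*).
Proof.
rewrite mxE; congr (_ / _); congr (1 - _).
have -> : (w x j)^* = x%:C%C * (alpha 0 j)^* by rewrite /w rmorphM /= conj_real_complex.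
by rewrite rmorphXn /= /w; ring.
Qed.

Lemma pick_matrix_form x c :
  quadratic_form (fun i j => pick_matrix z alpha x i j) c = pick_form z (w x) c.
Proof.
by apply: eq_bigr => i _; apply: eq_bigr => j _; rewrite pick_matrixE.
Qed.

Lemma psd_pick_matrix x :
  psdmx (pick_matrix z alpha x) <-> forall c, 0 <= pick_form z (w x) c.
Proof.
rewrite psdmx_quadratic_form; split=> h c; have := h c; by rewrite pick_matrix_form.
Qed.

Definition target_gram i j : C := alpha 0 i * (alpha 0 j)^* / (1 - z i * (z j)^*).

Lemma pick_form_scaled x c : pick_form z (w x) c =
  pick_form z (fun=> 0) c - (x ^+ 2)%:C%C * quadratic_form target_gram c.
Proof.
rewrite /pick_form /quadratic_form mulr_sumr -sumrB; apply: eq_bigr => i _.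
rewrite mulr_sumr -sumrB; apply: eq_bigr => j _.
rewrite -pick_matrixE mxE /target_gram mul0r subr0; ring.
Qed.

Lemma szego_ge0 c : 0 <= pick_form z (fun=> 0) c.
Proof.
have [c0|c0] := pselect (exists i, c i != 0); first exact/ltW/szego_positive.
rewrite /pick_form big1 // => i _; rewrite big1 // => j _.
have -> : c j = 0 by apply/eqP; apply: contra_notT c0 => cj; exists j.
by rewrite mulr0 mul0r.
Qed.

(** The Szego form at the coefficients conj(alpha_j) c_j. *)
Lemma target_gram_ge0 c : 0 <= quadratic_form target_gram c.
Proof.
have := szego_ge0 (fun j => (alpha 0 j)^* * c j); congr (0 <= _).
apply: eq_bigr => i _; apply: eq_bigr => j _.
by rewrite rmorphM /= conjCK mul0r subr0 /target_gram; ring.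
Qed.

Lemma pick_matrix_hermitian x i j :
  pick_matrix z alpha x j i = (pick_matrix z alpha x i j)^*.
Proof. by rewrite !pick_matrixE conj_pick_entry. Qed.

(** A nonsingular positive semidefinite Pick matrix can be scaled further; so the
    matrix at the largest admissible scale is singular. *)
Lemma admissible_increase x : 0 <= x -> (forall c, 0 <= pick_form z (w x) c) ->
  \det (pick_matrix z alpha x) != 0 -> exists2 y, x < y & pick_admissible y.
Proof.
move=> x0 qx dx.
have [||||e e0 eT] := @quadratic_form_perturb R n (fun i j => pick_matrix z alpha x i j)
    target_gram.
- exact: pick_matrix_hermitian.
- by move=> c; rewrite pick_matrix_form.
- exact: target_gram_ge0.
- by rewrite (_ : \matrix_(i, j) _ = pick_matrix z alpha x) //; apply/matrixP => i j; rewrite mxE.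
have y2 : 0 <= x ^+ 2 + e by rewrite addr_ge0 ?sqr_ge0 // ltW.
exists (Num.sqrt (x ^+ 2 + e)).
  rewrite -(@ltr_pXn2r _ 2) ?nnegrE ?sqrtr_ge0 // sqr_sqrtr //.
  by rewrite ltrDl.
split=> [|c]; first exact: sqrtr_ge0.
rewrite pick_form_scaled sqr_sqrtr // rmorphD mulrDl opprD addrA -pick_form_scaled.
by rewrite subr_ge0 -pick_matrix_form.
Qed.

Lemma det_pick_matrix0 : \det (pick_matrix z alpha 0) != 0.
Proof.
apply/det0P => -[v v0 vA].
have [i vi] : exists i, v 0 i != 0 by apply/rV0Pn.
have w0 : w 0 = (fun=> 0) by apply/funext => j; rewrite /w mul0r.
have : 0 < pick_form z (fun=> 0) (fun j => (v 0 j)^*).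
  by apply: szego_positive => //; exists i; rewrite conjC_eq0.
rewrite -w0 -pick_matrix_form.
suff -> : quadratic_form (fun i j => pick_matrix z alpha 0 i j) (fun j => (v 0 j)^*) = 0.
  by rewrite ltxx.
rewrite /quadratic_form exchange_big /=; apply: big1 => j _.
have -> : \sum_k (v 0 k)^*^* * (v 0 j)^* * pick_matrix z alpha 0 k j =
   (v 0 j)^* * (v *m pick_matrix z alpha 0) 0 j.
  by rewrite [in RHS]mxE mulr_sumr; apply: eq_bigr => k _; rewrite conjCK; ring.
by rewrite vA mxE mulr0.
Qed.

Lemma zero_admissible : pick_admissible 0.
Proof.
split=> // c; have -> : w 0 = (fun=> 0) by apply/funext => j; rewrite /w mul0r.
exact: szego_ge0.
Qed.

Hypothesis alpha_neq0 : alpha != 0.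

Lemma has_sup_admissible : has_sup pick_admissible.
Proof.
split; first by exists 0; exact: zero_admissible.
have [i ai] : exists i, alpha 0 i != 0 by apply/rV0Pn.
pose a := Normc.normc (alpha 0 i).
have aE : `|alpha 0 i| = a%:C%C by rewrite norm_normcE.
have a0 : 0 < a by rewrite -ltcR -aE normr_gt0.
exists a^-1 => x [x0 /(_ (fun j => (j == i)%:R))].
rewrite pick_form_single pmulr_lge0; last first.
  by rewrite invr_gt0; exact: defect_gt0.
rewrite -normCK /w normrM aE (ger0_norm (x := x%:C%C)) ?ler0c //.
rewrite -rmorphM subr_ge0 -rmorphXn -[1]/(1%:C)%C lecR expr_le1 ?mulr_ge0 ?(ltW a0) //.
by rewrite -ler_pdivlMr // mul1r.
Qed.

Definition threshold : R := sup pick_admissible.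
Local Notation t0 := threshold.

Lemma threshold_ub x : pick_admissible x -> x <= t0.
Proof. by move=> ax; apply: sup_upper_bound ax; exact: has_sup_admissible. Qed.

Lemma threshold_ge0 : 0 <= t0.
Proof. exact: threshold_ub zero_admissible. Qed.

Lemma threshold_gt0 : 0 < t0.
Proof.
have [y y0 /threshold_ub] := admissible_increase (lexx 0) zero_admissible.2 det_pick_matrix0.
exact: lt_le_trans.
Qed.

Lemma pick_form_scaled_real c : exists a tau : R, [/\ 0 <= a, 0 <= tau,
  (forall x, pick_form z (w x) c = (a - x ^+ 2 * tau)%:C%C) &
  (exists i, c i != 0) -> 0 < a].
Proof.
have aE := ge0_complexE (szego_ge0 c); have tE := ge0_complexE (target_gram_ge0 c).
exists (complex.Re (pick_form z (fun=> 0) c)), (complex.Re (quadratic_form target_gram c)).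
split.
- by rewrite -ler0c -aE szego_ge0.
- by rewrite -ler0c -tE target_gram_ge0.
- by move=> x; rewrite pick_form_scaled [in RHS]rmorphB [in RHS]rmorphM /= -aE -tE.
- by move=> c0; rewrite -ltcR -aE; exact: szego_positive.
Qed.

Lemma threshold_form_ge0 c : 0 <= pick_form z (w t0) c.
Proof.
have [a [tau [a0 tau0 E _]]] := pick_form_scaled_real c.
rewrite E ler0c subr_ge0 leNgt; apply/negP => h.
have t2 : 0 < tau.
  by rewrite lt_neqAle tau0 andbT; apply: contraTneq h => <-; rewrite mulr0 -leNgt.
have : Num.sqrt (a / tau) < t0.
  rewrite -(@ltr_pXn2r _ 2) ?nnegrE ?sqrtr_ge0 ?threshold_ge0 // sqr_sqrtr.
    by rewrite ltr_pdivrMr.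
  by rewrite divr_ge0.
move=> /(sup_gt has_sup_admissible.1) [x [x0 /(_ c)]].
rewrite E ler0c subr_ge0 -ler_pdivlMr // => xa; rewrite ltNge => /negP; apply.
by rewrite -(ger0_norm x0) -sqrtr_sqr; exact: ler_wsqrtr.
Qed.

Lemma threshold_det : \det (pick_matrix z alpha t0) = 0.
Proof.
apply/eqP; apply: contraT => d0.
have [y ty /threshold_ub] := admissible_increase threshold_ge0 threshold_form_ge0 d0.
by rewrite leNgt ty.
Qed.

(** The form is a - x^2 tau with a > 0 and tau >= 0, so being nonnegative at the
    threshold makes it positive below. *)
Lemma below_threshold_positive x : 0 <= x < t0 -> pick_positive z (w x).
Proof.
move=> /andP[x0 xt] c c0; have [a [tau [_ tau0 E /(_ c0) a0]]] := pick_form_scaled_real c.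
have := threshold_form_ge0 c; rewrite !E ler0c ltcR !subr_ge0 subr_gt0 => ta.
move: tau0; rewrite le_eqVlt => /predU1P[<-|tau0]; first by rewrite mulr0.
apply: lt_le_trans ta; rewrite ltr_pM2r //.
by rewrite ltr_pXn2r // nnegrE // threshold_ge0.
Qed.

Lemma interpolation_admissible s : 0 < s ->
  interpolation_values z ((s^-1)%:C%C *: alpha) -> pick_admissible s^-1.
Proof.
move=> s0 [f [df fsup fz]]; split; first by rewrite invr_ge0 ltW.
move=> c.
have f1 u : `|u| < 1 -> `|f u| <= 1.
  move=> u1; rewrite norm_normcE -[1]/(1%:C)%C lecR -lee_fin ltW //.
  apply: le_lt_trans fsup; apply: ereal_sup_ubound; by exists u.
have wf i : w s^-1 i = f (z i).
  by have := congr1 (fun m : 'rV_n => m 0 i) fz; rewrite /= !mxE.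
have := pick_necessity c df f1 z1; congr (0 <= _).
by apply: eq_bigr => i _; apply: eq_bigr => j _; rewrite !wf.
Qed.

(** Interpolating at a scale y between 1/s and the threshold and multiplying by
    1/(s y) < 1 makes the supremum strictly less than 1. *)
Lemma admissible_interpolation s : t0^-1 < s ->
  interpolation_values z ((s^-1)%:C%C *: alpha).
Proof.
move=> ts; have t_gt0 := threshold_gt0.
have s0 : 0 < s by apply: lt_trans ts; rewrite invr_gt0.
have st : s^-1 < t0 by rewrite invf_plt ?posrE.
have sV0 : 0 < s^-1 by rewrite invr_gt0.
have [y sy yt] : exists2 y, s^-1 < y & y < t0.
  by exists ((s^-1 + t0) / 2); rewrite ?midf_lt.
have y0 := lt_trans sV0 sy.
have [f [df f1 fz]] : exists f : C -> C, [/\ holomorphic_on (@unit_disc R) f,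
    forall u, `|u| < 1 -> `|f u| <= 1 & forall i, f (z i) = w y i].
  by apply: pick_sufficiency => //; apply: below_threshold_positive; rewrite yt ltW.
pose k := s^-1 / y.
have k0 : 0 <= k by rewrite divr_ge0 // ltW.
have k1 : k < 1 by rewrite ltr_pdivrMr // mul1r.
exists (fun u => k%:C%C * f u); split.
- move=> u u1.
  by apply: (@derivableM C C^o (cst k%:C%C) f); [exact: derivable_cst|exact: df].
- apply: (@le_lt_trans _ _ k%:E); last by rewrite lte_fin.
  apply: ge_ereal_sup => _ [u u1 <-]; rewrite lee_fin -lecR -norm_normcE normrM.
  rewrite ger0_norm ?ler0c //; rewrite -[leRHS]mulr1; apply: ler_wpM2l.
    by rewrite ler0c.
  exact: f1.
- apply/rowP => i; rewrite !mxE fz /w mulrA -rmorphM /k divfK //.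
  by rewrite gt_eqF.
Qed.

Lemma minkowski_threshold :
  minkowski_functional (interpolation_values z) alpha = t0^-1.
Proof.
have t_gt0 := threshold_gt0; have tV0 : 0 < t0^-1 by rewrite invr_gt0.
rewrite /minkowski_functional; set S := [set s | _].
have Slb : lbound S t0^-1.
  move=> s [s0 /(interpolation_admissible s0) /threshold_ub].
  by rewrite invf_ple ?posrE.
have Sin s : t0^-1 < s -> S s.
  move=> ts; split; first exact: lt_trans ts.
  exact: admissible_interpolation.
have S0 : S !=set0 by exists (t0^-1 + 1); apply: Sin; rewrite ltrDl.
apply/eqP; rewrite eq_le; apply/andP; split; last exact: lb_le_inf.
rewrite leNgt; apply/negP => h.
have /andP[m1 m2] : t0^-1 < (t0^-1 + inf S) / 2 < inf S by rewrite !midf_lt.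
have : inf S <= (t0^-1 + inf S) / 2 by apply: ge_inf; [exists t0^-1|exact: Sin].
by rewrite leNgt m2.
Qed.

End PickThreshold.

Unset Implicit Arguments.

Theorem theorem3p7 (R : realType) (n : nat) (z : 'I_n -> R[i])
  (alpha : 'rV[R[i]]_n)
  (hz : forall i, unit_disc (z i))
  (z_inj : injective z)
  (alpha_neq0 : alpha != 0) :
  exists t : R,
    is_max [set x : R | [/\ 0 <= x,
                            \det (pick_matrix z alpha x) = 0 &
                            psdmx (pick_matrix z alpha x)]] t /\
    t = 1 / minkowski_functional (interpolation_values z) alpha.
Proof.
exists (threshold z alpha); split; last first.
  by rewrite (minkowski_threshold hz z_inj alpha_neq0) div1r invrK.
split.
  split; first exact: threshold_ge0 hz z_inj alpha_neq0.
    exact: threshold_det.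
  apply/psd_pick_matrix => c; exact: threshold_form_ge0.
move=> x [x0 _ /psd_pick_matrix qx].
by apply: threshold_ub.
Qed.
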